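(* Let $X$ be a metric space and $R$ a ring. If $X$ is uniformly contractible at infinity, then its coarse cohomology $HX^*(X;R)$ is isomorphic to its boundedly supported cohomology $HB^*(X;R)$.
   Context: Uniformly contractible at infinity: there exist two non-decreasing functions $\rho,\mu:\mathbb{R}_+\to\mathbb{R}_+$ and a basepoint $b\in X$ such that any set $B\subset X$ of diameter $r$ with $d(b,B)\ge\mu(r)$ is contractible inside a set of diameter $\rho(r)$ (i.e. the inclusion of $B$ into some set of diameter at most $\rho(r)$ is null-homotopic). Cochains: $C^n(X;R)$ is the set of all functions $\phi:X^{n+1}\to R$ with $(d\phi)(x_0,\dots,x_{n+1})=\sum_{i}(-1)^i\phi(x_0,\dots,\hat{x_i},\dots,x_{n+1})$. Let $X^\infty$ be the set of eventually constant sequences in $X$ with the sup metric, and $i:X^{n+1}\to X^\infty$, $(x_0,\dots,x_n)\mapsto(x_0,\dots,x_n,x_n,\dots)$. Put $|\phi|=\{i(\sigma):\sigma\in X^{n+1},\ \phi(\sigma)\ne0\}\subset X^\infty$, let $\Delta=i(X)$ be the diagonal of $X^\infty$, and let $N_r$ denote the $r$-neighborhood. Let $\|\phi\|$ be the intersection of the diagonal $\{(x,\dots,x)\mid x\in X\}\subset X^{n+1}$ with the closure of the support of $\phi:X^{n+1}\to R$ in $X^{n+1}$. Coarse cohomology $HX^*(X;R)$ is the cohomology of $CX^*(X;R)=\{\phi\in C^*(X;R)\mid |\phi|\cap N_r(\Delta)\text{ is bounded for all } r\}$ with differential $d$. Boundedly supported cohomology $HB^*(X;R)$ is the cohomology of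 $CB^*(X;R)=\{\phi\in C^*(X;R)\mid \|\phi\|\text{ is bounded}\}$ with differential $d$. *)

(* Defs.v *)
From HB Require Import structures.
From mathcomp Require Import all_boot all_order all_algebra.
From mathcomp Require Import zify.
From mathcomp Require Import interval_inference boolp classical_sets functions.
From mathcomp Require Import reals ereal topology normedtype.

Set Implicit Arguments.
Unset Strict Implicit.
Unset Printing Implicit Defensive.
Import Order.TTheory GRing.Theory Num.Theory.
Import numFieldTopology.Exports.

Local Open Scope classical_set_scope.
Local Open Scope ring_scope.

Section Submodule.
Context (A : pzRingType) (V : lmodType A) (S : submodClosed V).

Record submodule := Submodule { submodule_val : V; _ : submodule_val \in S }.

HB.instance Definition _ := [isSub for submodule_val].
HB.instance Definition _ := [Choice of submodule by <:].
HB.instance Definition _ := [SubChoice_isSubLmodule of submodule by <:].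

End Submodule.

Section QuotientModule.
Context (A : pzRingType) (V : lmodType A) (S : submodClosed V).

Definition submod_pred : pred V := fun v => v \in S.

Lemma submod_pred_zmod_closed : zmod_closed submod_pred.
Proof. exact: (GRing.submod_closedB (submodClosedP S)). Qed.

HB.instance Definition _ := GRing.isZmodClosed.Build V submod_pred
  submod_pred_zmod_closed.

Definition submod_zmodClosed : zmodClosed V :=
  GRing.ZmodClosed.clone V submod_pred _.

Definition quotmod := Quotient.quot submod_zmodClosed.

HB.instance Definition _ := GRing.Zmodule.on quotmod.

Local Open Scope quotient_scope.

Definition quotmod_pi (v : V) : quotmod :=
  \pi_(Quotient.quot submod_zmodClosed) v.

Definition quotmod_scale (a : A) (q : quotmod) : quotmod :=
  quotmod_pi (a *: repr (q : Quotient.quot submod_zmodClosed)).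

Lemma quotmod_piP v w : quotmod_pi v = quotmod_pi w <-> v - w \in S.
Proof.
split; first by move/eqP; rewrite /quotmod_pi -Quotient.idealrBE.
by move=> h; apply/eqP; rewrite /quotmod_pi -Quotient.idealrBE.
Qed.

Lemma quotmod_pi_surj q : exists v, quotmod_pi v = q.
Proof. by exists (repr (q : Quotient.quot submod_zmodClosed)); apply: reprK. Qed.

Lemma quotmod_piD v w : quotmod_pi (v + w) = quotmod_pi v + quotmod_pi w.
Proof. exact: raddfD. Qed.

Lemma quotmod_scaleE a v : quotmod_scale a (quotmod_pi v) = quotmod_pi (a *: v).
Proof.
apply/quotmod_piP; rewrite -scalerBr; apply: rpredZ; apply/quotmod_piP.
exact: reprK.
Qed.

Let scaleA a b q :
  quotmod_scale a (quotmod_scale b q) = quotmod_scale (a * b) q.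
Proof. by case: (quotmod_pi_surj q) => v <-; rewrite !quotmod_scaleE scalerA. Qed.

Let scale1 : left_id 1 quotmod_scale.
Proof.
by move=> q; case: (quotmod_pi_surj q) => v <-; rewrite quotmod_scaleE scale1r.
Qed.

Let scaleDr : right_distributive quotmod_scale +%R.
Proof.
move=> a p q; case: (quotmod_pi_surj p) (quotmod_pi_surj q) => v <- [w <-].
by rewrite -quotmod_piD !quotmod_scaleE scalerDr quotmod_piD.
Qed.

Let scaleDl q : {morph quotmod_scale^~ q : a b / a + b}.
Proof.
move=> a b; case: (quotmod_pi_surj q) => v <-.
by rewrite !quotmod_scaleE scalerDl quotmod_piD.
Qed.

HB.instance Definition _ := GRing.Zmodule_isLmodule.Build A quotmod
  scaleA scale1 scaleDr scaleDl.

End QuotientModule.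

Record cochain_complex (A : pzRingType) := CochainComplex {
  cochains :> nat -> lmodType A;
  diff : forall n, {linear cochains n -> cochains n.+1};
  diff_diff : forall n (c : cochains n), diff n.+1 (diff n c) = 0
}.

Section Cohomology.
Context (A : pzRingType) (C : cochain_complex A).

Definition cocycle n : pred (C n) := fun c => diff C n c == 0.

Lemma cocycle_submod_closed n : submod_closed (@cocycle n).
Proof.
split; first by rewrite unfold_in /cocycle linear0.
move=> a c c'; rewrite !unfold_in /cocycle => /eqP dc /eqP dc'.
by rewrite linearP dc dc' scaler0 addr0.
Qed.

HB.instance Definition _ n := GRing.isSubmodClosed.Build A (C n) (@cocycle n)
  (GRing.submod_closed_semi (@cocycle_submod_closed n)).

Definition cocycles n := submodule (GRing.SubmodClosed.clone A (C n) (@cocycle n) _).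
HB.instance Definition _ n := GRing.Lmodule.on (cocycles n).

(* The complexes live in degrees [n >= 0], so only [0] bounds in degree 0. *)
Definition coboundary n : pred (cocycles n) :=
  match n with
  | 0 => fun z => z == 0
  | m.+1 => fun z => `[< exists c : C m, val z = diff C m c >]
  end.

Lemma coboundary_submod_closed n : submod_closed (@coboundary n).
Proof.
case: n => [|n]; split; rewrite ?unfold_in /=.
- by [].
- move=> a z z'; rewrite !unfold_in /= => /eqP-> /eqP->.
  by rewrite scaler0 addr0.
- by apply/asboolP; exists 0; rewrite !linear0.
- move=> a z z'; rewrite !unfold_in /= => /asboolP[c zc] /asboolP[c' zc'].
  by apply/asboolP; exists (a *: c + c'); rewrite !linearP zc zc'.
Qed.

HB.instance Definition _ n := GRing.isSubmodClosed.Build A (cocycles n)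
  (@coboundary n) (GRing.submod_closed_semi (@coboundary_submod_closed n)).

Definition cohomology n : lmodType A :=
  quotmod (GRing.SubmodClosed.clone A (cocycles n) (@coboundary n) _).

End Cohomology.

Section Subcomplex.
Context (A : pzRingType) (C : cochain_complex A).
Context (S : forall n, submodClosed (C n)).
Hypothesis dS : forall n c, c \in S n -> diff C n c \in S n.+1.

Definition subdiff n (c : submodule (S n)) : submodule (S n.+1) :=
  Submodule (dS (valP c)).

Lemma subdiff_linear n : linear (@subdiff n).
Proof. by move=> a c c'; apply: val_inj; rewrite /= !linearP. Qed.

HB.instance Definition _ n := GRing.isLinear.Build A
  (submodule (S n)) (submodule (S n.+1)) *:%R (@subdiff n) (@subdiff_linear n).

Lemma subdiff_subdiff n (c : submodule (S n)) : subdiff (subdiff c) = 0.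
Proof. by apply: val_inj; rewrite /= diff_diff. Qed.

Definition subcomplex : cochain_complex A :=
  @CochainComplex A (fun n => submodule (S n)) (fun n => @subdiff n)
    subdiff_subdiff.

End Subcomplex.

Section Cochains.
Context (X : Type) (A : pzRingType).

(* [A^o] makes the functions a left module, by pointwise multiplication. *)
Definition cochain n := ('I_n.+1 -> X) -> A^o.
HB.instance Definition _ n := GRing.Lmodule.on (cochain n).

(* [x \o lift i] is the tuple [x] with its entry of index [i] removed. *)
Definition codiff n (phi : cochain n) : cochain n.+1 :=
  fun x => \sum_(i < n.+2) (-1) ^+ i * phi (x \o lift i).

Lemma codiff_linear n : linear (@codiff n).
Proof.
move=> a phi psi; apply/funext => x.
rewrite /codiff [in RHS]/GRing.add /= [in RHS]/GRing.scale /=.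
rewrite [in RHS]/GRing.scale /= mulr_sumr -big_split; apply: eq_bigr => i _ /=.
by rewrite mulrDr !mulrA (commr_sign a).
Qed.

HB.instance Definition _ n := GRing.isLinear.Build A (cochain n)
  (cochain n.+1) *:%R (@codiff n) (@codiff_linear n).

Lemma codiff_codiff n (phi : cochain n) : codiff (codiff phi) = 0.
Proof.
apply/funext => x; rewrite /codiff.
pose G (p : 'I_n.+3 * 'I_n.+2) : A :=
  (-1) ^+ (p.1 + p.2) * phi (x \o lift p.1 \o lift p.2).
transitivity (\sum_p G p).
  under eq_bigr => i _ do rewrite mulr_sumr.
  rewrite pair_bigA; apply: eq_bigr => -[i j] _ /=.
  by rewrite mulrA -exprD.
(* The bijection exchanging the two orders of removal of two entries. *)
pose down (p : 'I_n.+3 * 'I_n.+2) : 'I_n.+3 * 'I_n.+2 :=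
  (inord p.2, inord p.1.-1).
pose up (p : 'I_n.+3 * 'I_n.+2) : 'I_n.+3 * 'I_n.+2 :=
  (inord p.2.+1, inord p.1).
rewrite (bigID (fun p : 'I_n.+3 * 'I_n.+2 => (p.2 < p.1)%N)) /=.
rewrite [X in X + _](reindex_onto up down); last first.
  move=> [[i hi] [j hj]] /= ij; congr pair; apply: val_inj;
    rewrite /= !inordK /= ?inordK //; lia.
rewrite -[RHS](addNr (\sum_(p : 'I_n.+3 * 'I_n.+2 | ~~ (p.2 < p.1)%N) G p)); congr (_ + _).
have updown i j : (i < n.+3)%N -> (j < n.+2)%N ->
    ((inord i : 'I_n.+2) < (inord j.+1 : 'I_n.+3))%N &&
    (((inord (inord i : 'I_n.+2) : 'I_n.+3) == i :> nat) &&
     ((inord (inord j.+1 : 'I_n.+3).-1 : 'I_n.+2) == j :> nat)) = ~~ (j < i)%N.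
  move=> hi hj; have ej : (inord j.+1 : 'I_n.+3) = j.+1 :> nat by rewrite inordK.
  rewrite ej /= (inordK hj) eqxx andbT ltnS.
  have [hi2|hi2] := ltnP i n.+2.
    by rewrite (inordK hi2) inordK // eqxx andbT -leqNgt.
  rewrite (leq_trans hj hi2) /inord [insubd _ i]/insubd insubF; last by rewrite ltnNge hi2.
  by rewrite insubdK // -?topredE //=; case: i hi2 {hi} => // i _; rewrite andbF.
rewrite -sumrN; apply: eq_big => [[[i hi] [j hj]]|[[i hi] [j hj]]] /=.
  by rewrite -(updown i j hi hj).
move=> c; have ij : (i <= j)%N by rewrite leqNgt -(updown i j hi hj).
have hi2 : (i < n.+2)%N by exact: leq_ltn_trans ij hj.
rewrite /G /= (inordK hi2) (@inordK n.+2 j.+1) // addSn exprS mulN1r mulNr addnC.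
congr (- (_ * phi _)); apply/funext => k /=; congr x; apply: val_inj.
rewrite /= /bump (inordK hi2) (@inordK n.+2 j.+1) //; lia.
Qed.

Definition cochain_cplx : cochain_complex A :=
  @CochainComplex A (fun n => cochain n) (fun n => @codiff n) codiff_codiff.

End Cochains.

Section Metric.
Context {K : realType} {X : metricType K}.

Definition diameter (B : set X) : \bar K :=
  ereal_sup [set (mdist x y)%:E | x in B & y in B].

Definition dist_to_set (b : X) (B : set X) : \bar K :=
  ereal_inf [set (mdist b x)%:E | x in B].

(* The inclusion of [B] into [C] is null-homotopic: only the values of the
   homotopy [h] on [B `*` `[0, 1]] matter. *)
Definition null_homotopic_in (B C : set X) :=
  exists c : X, exists h : X * K -> X,
    [/\ C c,
        {within B `*` `[0, 1], continuous h},
        h @` (B `*` `[0, 1]) `<=` C,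
        forall x, B x -> h (x, 0) = x &
        forall x, B x -> h (x, 1) = c].

(* The supremum distance between families of points; it is only meaningful
   when the distances are bounded, as for finite families and for eventually
   constant sequences. *)
Definition sup_dist {I : Type} (x y : I -> X) : K :=
  sup (range (fun k => mdist (x k) (y k))).

Definition sup_bounded {I : Type} (S : set (I -> X)) :=
  exists M : K, forall x y, S x -> S y -> sup_dist x y <= M.

(* X^oo is this set, with the metric [sup_dist]. *)
Definition eventually_constant : set (nat -> X) :=
  [set x | exists N, forall k, (N <= k)%N -> x k = x N].

Definition stutter n (s : 'I_n.+1 -> X) : nat -> X :=
  fun k => s (inord (minn k n)).

Definition diagonal_seq : set (nat -> X) := range (@stutter 0).

Definition neighborhood (r : K) (S : set (nat -> X)) : set (nat -> X) :=
  [set x | eventually_constant x /\ exists2 y, S y & sup_dist x y < r].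

Definition diagonal n : set {ptws 'I_n.+1 -> X} := range (fun x : X => cst x).

End Metric.
Arguments null_homotopic_in {K X}.

Definition unif_contractible_at_infinity (K : realType) (X : metricType K) :=
  exists (rho mu : {nonneg K} -> {nonneg K}) (b : X),
    [/\ {homo rho : r s / r <= s},
        {homo mu : r s / r <= s} &
        forall (r : {nonneg K}) (B : set X),
          diameter B = r%:num%:E -> ((mu r)%:num%:E <= dist_to_set b B)%E ->
          exists C : set X, (diameter C <= (rho r)%:num%:E)%E /\
            B `<=` C /\ null_homotopic_in B C].

Section SupDist.
Context {K : realType} {X : metricType K}.

Definition finite_dist {I : Type} (x y : I -> X) :=
  exists M : K, forall k, mdist (x k) (y k) <= M.

Lemma sup_dist_le {I : Type} (k0 : I) (x y : I -> X) (M : K) :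
  (forall k, mdist (x k) (y k) <= M) -> sup_dist x y <= M.
Proof.
move=> xyM; apply: ge_sup; first by exists (mdist (x k0) (y k0)); exists k0.
by move=> _ [k _ <-].
Qed.

Lemma mdist_sup_dist {I : Type} (x y : I -> X) k :
  finite_dist x y -> mdist (x k) (y k) <= sup_dist x y.
Proof.
move=> [M xyM]; apply: ub_le_sup; last by exists k.
by exists M => _ [l _ <-].
Qed.

Lemma sup_distC {I : Type} (x y : I -> X) : sup_dist x y = sup_dist y x.
Proof.
by rewrite /sup_dist; under eq_fun do rewrite metric_sym.
Qed.

Lemma finite_distC {I : Type} (x y : I -> X) :
  finite_dist x y -> finite_dist y x.
Proof. by move=> [M xyM]; exists M => k; rewrite metric_sym. Qed.

Lemma sup_dist_triangle {I : Type} (k0 : I) (x y z : I -> X) :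
  finite_dist x y -> finite_dist y z ->
  sup_dist x z <= sup_dist x y + sup_dist y z.
Proof.
move=> xy yz; apply: (sup_dist_le k0) => k.
by apply: (le_trans (metric_triangle _ (y k) _)); apply: lerD;
  apply: mdist_sup_dist.
Qed.

Lemma finite_dist_ord n (x y : 'I_n -> X) : finite_dist x y.
Proof.
exists (\sum_(k < n) mdist (x k) (y k)) => k.
by rewrite (bigD1 k) //= lerDl sumr_ge0 // => l _; apply: mdist_ge0.
Qed.

Lemma finite_dist_eventually_constant (x y : nat -> X) :
  eventually_constant x -> eventually_constant y -> finite_dist x y.
Proof.
move=> [N xN] [P yP]; have [M xyM] :=
  finite_dist_ord (fun k : 'I_(maxn N P).+1 => x k) (fun k => y k).
exists M => k; have [kNP|kNP] := ltnP k (maxn N P).+1.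
  exact: (xyM (Ordinal kNP)).
have := xyM ord_max; rewrite /= (xN k) ?(yP k); [|lia|lia].
by rewrite (xN (maxn N P)) ?(yP (maxn N P)) // ?leq_maxl ?leq_maxr.
Qed.

Lemma eventually_constant_stutter n (s : 'I_n.+1 -> X) :
  eventually_constant (stutter s).
Proof. by exists n => k nk; rewrite /stutter (minn_idPr nk) minnn. Qed.

Lemma sup_boundedS {I : Type} (S T : set (I -> X)) :
  S `<=` T -> sup_bounded T -> sup_bounded S.
Proof. by move=> ST [M TM]; exists M => x y /ST Tx /ST Ty; apply: TM. Qed.

Lemma sup_boundedU {I : Type} (k0 : I) (S T : set (I -> X)) :
  (forall x y, S x -> T y -> finite_dist x y) ->
  (forall x y, S x -> S y -> finite_dist x y) ->
  (forall x y, T x -> T y -> finite_dist x y) ->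
  sup_bounded S -> sup_bounded T -> sup_bounded (S `|` T).
Proof.
move=> fST fS fT.
have [->|/set0P[s Ss]] := eqVneq S set0; first by rewrite set0U.
have [->|/set0P[t Tt]] := eqVneq T set0; first by rewrite setU0.
move=> [M SM] [N TN].
have st0 : 0 <= sup_dist s t.
  by apply: le_trans (mdist_sup_dist k0 (fST _ _ Ss Tt)); apply: mdist_ge0.
have M0 : 0 <= M.
  apply: le_trans (SM _ _ Ss Ss).
  by apply: le_trans (mdist_sup_dist k0 (fS _ _ Ss Ss)); apply: mdist_ge0.
have N0 : 0 <= N.
  apply: le_trans (TN _ _ Tt Tt).
  by apply: le_trans (mdist_sup_dist k0 (fT _ _ Tt Tt)); apply: mdist_ge0.
have ST x y : S x -> T y -> sup_dist x y <= M + sup_dist s t + N.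
  move=> Sx Ty; apply: (le_trans (sup_dist_triangle k0 (y := t) _ _)).
  - exact: fST.
  - exact: fT.
  - apply: lerD; last exact: TN.
    apply: (le_trans (sup_dist_triangle k0 (y := s) _ _)).
    + exact: fS.
    + exact: fST.
    + by rewrite lerD2r SM.
exists (M + sup_dist s t + N) => x y [Sx|Tx] [Sy|Ty].
- by apply: (le_trans (SM _ _ Sx Sy)); rewrite -addrA lerDl addr_ge0.
- exact: ST.
- by rewrite sup_distC; apply: ST.
- by apply: (le_trans (TN _ _ Tx Ty)); rewrite lerDr addr_ge0.
Qed.

End SupDist.

Section Supports.
Context {K : realType} {X : metricType K} {A : pzRingType}.

Definition coch_support n (phi : cochain X A n) : set {ptws 'I_n.+1 -> X} :=
  [set s | phi s <> 0].

(* [seq_support phi] is |phi| and [diag_support phi] is ||phi||. *)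
Definition seq_support n (phi : cochain X A n) : set (nat -> X) :=
  @stutter K X n @` coch_support phi.

Definition diag_support n (phi : cochain X A n) : set {ptws 'I_n.+1 -> X} :=
  @diagonal K X n `&` closure (coch_support phi).

Lemma coch_support_linear n (a : A) (phi psi : cochain X A n) :
  coch_support (a *: phi + psi) `<=` coch_support phi `|` coch_support psi.
Proof.
move=> s /= h; have [phi0|] := eqVneq (phi s) 0; last by move/eqP; left.
right=> psi0; apply: h; rewrite /GRing.add /= /GRing.scale /= phi0 psi0.
by rewrite scaler0 addr0.
Qed.

Lemma coch_support_codiff n (phi : cochain X A n) s :
  coch_support (codiff phi) s -> exists i, coch_support phi (s \o lift i).
Proof.
move=> h; apply: contra_notP h => /forallNP h.
rewrite /codiff big1 // => i _; have /contrapT -> := h i.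
by rewrite mulr0.
Qed.

Definition coarse n : pred (cochain X A n) := fun phi =>
  `[< forall r : K,
        sup_bounded (seq_support phi `&` neighborhood r diagonal_seq) >].

Definition bsupp n : pred (cochain X A n) := fun phi =>
  `[< sup_bounded (diag_support phi) >].

Lemma coarse_submod_closed n : submod_closed (@coarse n).
Proof.
split.
  apply/asboolP => r; exists 0 => x y [[s /=]]; first by [].
move=> a phi psi /asboolP cphi /asboolP cpsi; apply/asboolP => r.
have ev (c : cochain X A n) x :
  (seq_support c `&` neighborhood r diagonal_seq) x ->
  eventually_constant x by move=> [_ []].
apply: (@sup_boundedS _ _ _ _ _ _
  (sup_boundedU 0%N _ _ _ (cphi r) (cpsi r))) => [x [[s hs <-] xr]||| ].
- by have [h|h] := coch_support_linear hs; [left|right]; split => //; exists s.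
- by move=> x y /ev ? /ev ?; apply: finite_dist_eventually_constant.
- by move=> x y /ev ? /ev ?; apply: finite_dist_eventually_constant.
- by move=> x y /ev ? /ev ?; apply: finite_dist_eventually_constant.
Qed.

HB.instance Definition _ n := GRing.isSubmodClosed.Build A (cochain X A n)
  (@coarse n) (GRing.submod_closed_semi (@coarse_submod_closed n)).

Lemma stutter_face n (s : 'I_n.+2 -> X) (i : 'I_n.+2) k :
  exists l, stutter (s \o lift i) k = stutter s l.
Proof.
exists (lift i (inord (minn k n) : 'I_n.+1)).
have ln := ltn_ord (lift i (inord (minn k n) : 'I_n.+1)).
by rewrite [RHS]/stutter (minn_idPl _) // inord_val.
Qed.

Lemma coarse_codiff n (phi : cochain X A n) :
  phi \in @coarse n -> codiff phi \in @coarse n.+1.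
Proof.
move=> /asboolP cphi; apply/asboolP => r; have [M phiM] := cphi r.
have face x : (seq_support (codiff phi) `&` neighborhood r diagonal_seq) x ->
  exists2 y, (seq_support phi `&` neighborhood r diagonal_seq) y &
    eventually_constant x /\ sup_dist x y <= r + r.
  move=> [[s /coch_support_codiff[i si] <-]] [_ [_ [p _ <-] spr]].
  have fin t : finite_dist (@stutter K X n.+1 s) (@stutter K X 0 t).
    by apply: finite_dist_eventually_constant; exact: eventually_constant_stutter.
  have fs k : mdist (stutter s k) (p ord0) <= sup_dist (stutter s) (stutter p).
    apply: le_trans (mdist_sup_dist k (fin p)).
    by rewrite /(stutter p) (ord1 (inord _)).
  have fss : sup_dist (stutter (s \o lift i)) (stutter p) <= sup_dist (stutter s) (stutter p).
    apply: (sup_dist_le 0%N) => k; rewrite {2}/stutter (ord1 (inord _)).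
    by have [l ->] := stutter_face s i k.
  exists (stutter (s \o lift i)); split.
  - by exists (s \o lift i).
  - split; first exact: eventually_constant_stutter.
    by exists (stutter p); [exists p|apply: le_lt_trans spr].
  - exact: eventually_constant_stutter.
  - have e1 := @eventually_constant_stutter K X.
    apply: (le_trans (sup_dist_triangle 0%N (y := stutter p) _ _)).
    + exact: finite_dist_eventually_constant.
    + exact: finite_dist_eventually_constant.
    + apply: lerD; first exact: ltW.
      by rewrite sup_distC ltW // (le_lt_trans fss).
exists ((r + r) + (M + (r + r))) => x y /face[x' Sx' [ex xx']] /face[y' Sy' [ey yy']].
have [ex' ey'] : eventually_constant x' /\ eventually_constant y'.
  by split; [case: Sx' => _ []|case: Sy' => _ []].
apply: (le_trans (sup_dist_triangle 0%N (y := x') _ _)).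
- exact: finite_dist_eventually_constant.
- exact: finite_dist_eventually_constant.
- apply: lerD => //; apply: (le_trans (sup_dist_triangle 0%N (y := y') _ _)).
  + exact: finite_dist_eventually_constant.
  + exact: finite_dist_eventually_constant.
  + by apply: lerD; [apply: phiM|rewrite sup_distC].
Qed.

Lemma bsupp_submod_closed n : submod_closed (@bsupp n).
Proof.
split.
  apply/asboolP; exists 0 => x y [_]; rewrite (_ : coch_support _ = set0).
    by rewrite closure0.
  by apply/seteqP; split => s //=.
move=> a phi psi /asboolP cphi /asboolP cpsi; apply/asboolP.
apply: (@sup_boundedS _ _ _ _ _ _
  (sup_boundedU ord0 _ _ _ cphi cpsi)) => [x [dx /closure_subset]||| ].
- by move=> /(_ _ (@coch_support_linear _ a phi psi)); rewrite closureU => -[]; [left|right].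
- by move=> *; apply: finite_dist_ord.
- by move=> *; apply: finite_dist_ord.
- by move=> *; apply: finite_dist_ord.
Qed.

HB.instance Definition _ n := GRing.isSubmodClosed.Build A (cochain X A n)
  (@bsupp n) (GRing.submod_closed_semi (@bsupp_submod_closed n)).

Lemma face_continuous n (i : 'I_n.+2) :
  continuous (fun s : {ptws 'I_n.+2 -> X} => s \o lift i : {ptws 'I_n.+1 -> X}).
Proof.
move=> s; apply/cvg_sup; first exact/fmap_filter/nbhs_filter.
move=> k U [V [[W oW <-] sW WU]].
have /(_ s W) : continuous (fun s : {ptws 'I_n.+2 -> X} => s (lift i k)).
  exact: (@proj_continuous _ (fun=> X) (lift i k)).
move=> /(_ (open_nbhs_nbhs (conj oW sW))) sW'.
apply: (@filterS _ (nbhs s) _ [set t | W (t (lift i k))]) sW' => t Wt.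
exact: WU.
Qed.

Lemma bsupp_codiff n (phi : cochain X A n) :
  phi \in @bsupp n -> codiff phi \in @bsupp n.+1.
Proof.
move=> /asboolP[M phiM]; apply/asboolP; exists M.
have face p : closure (coch_support (codiff phi)) (cst p) ->
    diag_support phi (cst p).
  move=> cp; split; first by exists p.
  move=> B Bp.
  have fB : nbhs (cst p : {ptws 'I_n.+2 -> X})
      [set s : 'I_n.+2 -> X | forall i : 'I_n.+2, B (s \o lift i : 'I_n.+1 -> X)].
    apply: (@filter_forall {ptws 'I_n.+2 -> X} 'I_n.+2
      (fun i s => B (s \o lift i : 'I_n.+1 -> X)) _ (nbhs_filter _)).
    by move=> i; apply: (@face_continuous n i (cst p)).
  have [s [/coch_support_codiff[i si] sB]] := cp _ fB.
  by exists (s \o lift i); split => //; apply: sB.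
move=> _ _ [[p _ <-] /face cp] [[q _ <-] /face cq].
apply: (sup_dist_le ord0) => k; apply: le_trans (phiM _ _ cp cq).
by apply: (@mdist_sup_dist _ _ _ (cst p) (cst q) ord0); apply: finite_dist_ord.
Qed.

End Supports.

Section CoarseAndBounded.
Context {K : realType} (X : metricType K) (A : pzRingType).

Definition coarse_cplx : cochain_complex A :=
  @subcomplex A (cochain_cplx X A)
    (fun n => GRing.SubmodClosed.clone A (cochain X A n) (@coarse K X A n) _)
    (@coarse_codiff K X A).

Definition bsupp_cplx : cochain_complex A :=
  @subcomplex A (cochain_cplx X A)
    (fun n => GRing.SubmodClosed.clone A (cochain X A n) (@bsupp K X A n) _)
    (@bsupp_codiff K X A).

Definition coarse_cohomology n : lmodType A := cohomology coarse_cplx n.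

Definition bsupp_cohomology n : lmodType A := cohomology bsupp_cplx n.

End CoarseAndBounded.

(* Main.v *)
Require Import Defs.
From HB Require Import structures.
From mathcomp Require Import all_boot all_order all_algebra.
From mathcomp Require Import boolp reals topology.
From mathcomp Require Import interval_inference classical_sets functions wochoice.
From mathcomp Require Import ereal normedtype lra zify.

(* Coarse cochains are boundedly supported, and the inclusion is a
   quasi-isomorphism as soon as every boundedly supported [psi] with coarse
   [d psi] is, up to the coboundary of a boundedly supported cochain, coarse.
   Consider the double complex of functions [F x y] of two tuples, which vanish,
   for each [x], when the points of [y] are close enough to each other (and far
   from the base point, close to [x] up to a fixed bound).
   - In the direction of [y], it is exact where [x] is nonempty: [F x] is the
     coboundary of a cochain on a ball around [x] by a cone, and the homotopy
     invariance of Alexander-Spanier cohomology, applied to a contraction of this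
     ball, makes this cochain vanish on small tuples.
   - In the direction of [x], it is exact by a cone whose vertex is a point close
     to the first entry of [y]; by paracompactness this vertex can be chosen among
     finitely many points, locally in [y].
   A zigzag through this double complex, starting at [psi], yields the
   correction. *)

Set Implicit Arguments.
Unset Strict Implicit.
Unset Printing Implicit Defensive.
Import Order.TTheory GRing.Theory Num.Theory.
Import numFieldTopology.Exports.

Local Open Scope classical_set_scope.
Local Open Scope ring_scope.

(** * Coboundaries and prisms *)

Section SequenceCochains.
Context {T : Type} {V : zmodType}.
Implicit Types (c : seq T -> V) (s : seq T).

(* The augmented coboundary, on tuples of all sizes at once:
   [sdiff c [:: x] = c [::]]. *)
Fixpoint sdiff c s : V :=
  if s is x :: s' then c s' - sdiff (fun t => c (x :: t)) s' else 0.

Lemma sdiffB c c' s : sdiff (fun t => c t - c' t) s = sdiff c s - sdiff c' s.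
Proof.
elim: s c c' => [|x s IH] c c' /=; first by rewrite subrr.
rewrite (IH (fun t => c (x :: t)) (fun t => c' (x :: t))).
by rewrite !opprD !opprK addrACA.
Qed.

Lemma sdiffD c c' s : sdiff (fun t => c t + c' t) s = sdiff c s + sdiff c' s.
Proof.
elim: s c c' => [|x s IH] c c' /=; first by rewrite addr0.
by rewrite (IH (fun t => c (x :: t)) (fun t => c' (x :: t))) opprD addrACA.
Qed.

Lemma sdiff0 s : sdiff (fun=> 0) s = 0.
Proof. by elim: s => //= x s ->; rewrite subrr. Qed.

Lemma sdiff_sum (G : nat -> seq T -> V) M s :
  sdiff (fun t => \sum_(j < M) G j t) s = \sum_(j < M) sdiff (G j) s.
Proof.
elim: M => [|M IH].
  by rewrite big_ord0 -[RHS](sdiff0 s); congr sdiff; apply/funext => t; rewrite big_ord0.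
rewrite big_ord_recr -IH /= -(sdiffD (fun t => \sum_(j < M) G j t) (G M)).
by congr sdiff; apply/funext => t; rewrite big_ord_recr.
Qed.

Lemma sdiff_sdiff c s : sdiff (sdiff c) s = 0.
Proof.
elim: s c => //= x s IH c.
by rewrite (sdiffB c (sdiff (fun t => c (x :: t)))) IH subr0 subrr.
Qed.

Lemma sdiffE c s : sdiff c s =
  \sum_(i < size s) c (take i s ++ drop i.+1 s) *~ ((-1) ^+ i).
Proof.
elim: s c => [|x s IH] c /=; first by rewrite big_ord0.
rewrite big_ord_recl /= drop0 expr0 mulr1z IH -sumrN; congr (_ + _).
by apply: eq_bigr => i _; rewrite exprS mulN1r mulrNz.
Qed.

End SequenceCochains.

Lemma sdiff_map (T U : Type) (V : zmodType) (g : U -> T) (c : seq T -> V) (s : seq U) :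
  sdiff c (map g s) = sdiff (fun t => c (map g t)) s.
Proof. by elim: s c => //= x s IH c; rewrite IH. Qed.

Lemma eq_sdiff (T : eqType) (V : zmodType) (c c' : seq T -> V) (s : seq T) :
  (forall t, (size t).+1 = size s -> {subset t <= s} -> c t = c' t) ->
  sdiff c s = sdiff c' s.
Proof.
elim: s c c' => //= x s IH c c' cc'; rewrite cc' //; last first.
  by move=> u us; rewrite inE us orbT.
congr (_ - _); apply: IH => t ts sub; apply: cc'; first by rewrite /= ts.
by move=> u; rewrite !inE => /orP[->//|/sub ->]; rewrite orbT.
Qed.

Lemma sdiff_eq0 (T : eqType) (V : zmodType) (c : seq T -> V) (s : seq T) :
  (forall t, (size t).+1 = size s -> {subset t <= s} -> c t = 0) ->
  sdiff c s = 0.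
Proof. by move=> c0; rewrite -(sdiff0 s); apply: eq_sdiff. Qed.

(** Each coboundary acts on its own tuple, so the two commute without a sign. *)
Lemma sdiffC (T : Type) (V : zmodType) (F : seq T -> seq T -> V) x y :
  sdiff (fun x' => sdiff (F x') y) x =
  sdiff (fun y' => sdiff (fun x' => F x' y') x) y.
Proof.
elim: x F => [|u x IH] F /=; first by rewrite sdiff0.
by rewrite IH -sdiffB.
Qed.

Section Prism.
Context {T T' : Type} {V : zmodType}.
Implicit Types (f g : T -> T') (c : seq T' -> V).

(** Unfolded, this is the alternating sum over [i] of [c] at
    [f x_0, ..., f x_i, g x_i, ..., g x_n]. *)
Fixpoint prism f g c (s : seq T) : V :=
  if s is x :: s' then
    c (f x :: g x :: map g s') - prism f g (fun t => c (f x :: t)) s'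
  else 0.

Lemma prismB f g c c' s :
  prism f g (fun t => c t - c' t) s = prism f g c s - prism f g c' s.
Proof.
elim: s c c' => [|x s IH] c c' /=; first by rewrite subrr.
rewrite (IH (fun t => c (f x :: t)) (fun t => c' (f x :: t))).
by rewrite !opprD !opprK addrACA.
Qed.

(** Freezing the first entry at [f x] reduces to a shorter tuple; the other prism and coboundary
    terms occur twice with opposite signs. *)
Lemma prism_homotopy f g c s :
  sdiff (prism f g c) s + prism f g (sdiff c) s = c (map g s) - c (map f s).
Proof.
elim: s c => [|x s IH] c /=; first by rewrite addr0 subrr.
rewrite (sdiffB (fun t => c (f x :: g x :: map g t))).
rewrite (prismB f g c (sdiff (fun t => c (f x :: t)))).
have /(congr1 (+%R^~ (c (g x :: map g s) - c (f x :: map g s)))) :=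
  IH (fun t => c (f x :: t)).
rewrite /= sdiff_map.
set a := sdiff (prism _ _ _) s; set a' := prism _ _ (sdiff _) s.
set p := prism _ _ _ _; set q := sdiff _ _; set u := c _; set v := c _.
set w := c (f x :: map f s) => e.
transitivity (a + a' + (u - v) + ((p - p) + (q - q))).
  rewrite !opprD !opprK.
  by rewrite !addrA [LHS](AC 8 (3*8*4*5*1*7*6*2)).

by rewrite e !subrr !addr0 addrC addrA subrK.
Qed.

End Prism.

Lemma eq_prism (T T' : eqType) (V : zmodType) (f g : T -> T')
    (c c' : seq T' -> V) (s : seq T) :
  (forall t, size t = (size s).+1 ->
     (forall v, v \in t -> exists2 u, u \in s & v = f u \/ v = g u) ->
     c t = c' t) ->
  prism f g c s = prism f g c' s.
Proof.
elim: s c c' => //= x s IH c c' cc'; congr (_ - _).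
  apply: cc'; rewrite /= ?size_map // => v.
  rewrite !inE => /or3P[/eqP->|/eqP->|/mapP[u us ->]].
  - by exists x; rewrite ?inE ?eqxx //; left.
  - by exists x; rewrite ?inE ?eqxx //; right.
  - by exists u; rewrite ?inE ?us ?orbT //; right.
apply: IH => t ts sub; apply: cc'; first by rewrite /= ts.
move=> v; rewrite inE => /predU1P[->|/sub[u us uv]].
  by exists x; rewrite ?inE ?eqxx //; left.
by exists u; rewrite // inE us orbT.
Qed.

Lemma prism0 (T T' : Type) (V : zmodType) (f g : T -> T') (s : seq T) :
  prism f g (fun=> 0 : V) s = 0.
Proof. by elim: s => //= x s ->; rewrite subrr. Qed.

(** * Metric spaces *)

Lemma locally_finite_retraction (K : realType) (X : metricType K) :
  exists pi : X -> X, (forall x, mdist x (pi x) < 1) /\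
    forall z, exists (l : seq X) (e : K), 0 < e /\
      forall u, mdist z u < e -> pi u \in l.
Proof.
(* As in M. E. Rudin's proof that metric spaces are paracompact, [first x] is
   the first index, for a well-ordering, of a unit ball containing [x]. *)
have [R woR] := well_ordering_principle X.
have /choice[first firstP] : forall x : X, exists m : X, mdist x m < 1 /\
    forall m', mdist x m' < 1 -> R m m'.
  move=> x; have := woR [pred m | mdist x m < 1].
  case; first by exists x; rewrite inE mdistxx.
  move=> m [[]] m1 m2 _; exists m; split => // m' mm'; exact: m2.
have reflR x : R x x.
  have [|m [[/eqP mx mP] _]] := woR (pred1 x); first by exists x; rewrite inE.
  by rewrite -{1}mx; apply: mP; rewrite inE.
have totR x y : R x y \/ R y x.
  have [|m [[/pred2P[->|->] mP] _]] := woR (pred2 x y).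
  - by exists x; rewrite inE eqxx.
  - by left; apply: mP; rewrite !inE eqxx orbT.
  - by right; apply: mP; rewrite !inE eqxx.
have antiR x y : R x y -> R y x -> x = y.
  move=> xy yx; have [|m [_ mP]] := woR (pred2 x y).
    by exists x; rewrite inE eqxx.
  rewrite -(mP x) ?(mP y) //; split; rewrite ?inE ?eqxx ?orbT //;
    by move=> u; rewrite inE => /pred2P[->|->].
pose w n : K := n.+1%:R^-1.
have w0 n : 0 < w n by rewrite invr_gt0 ltr0Sn.
have wle i n : (i <= n)%N -> w n <= w i.
  by move=> ile; rewrite lef_pV2 ?posrE ?ltr0Sn // ler_nat.
(* The factor [3] is spent in [same]: two centers of equal level are each within [w] of their
   points, which are themselves within [w] of each other. *)
pose deep n x := forall u, mdist x u < 3 * w n -> mdist u (first x) < 1.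
have levelP y : exists n, `[< exists2 x, mdist x y < w n & deep n x >].
  have [d1 _] := firstP y.
  have [n nd] : exists n, 0 + w n < (1 - mdist y (first y)) / 3.
    by apply: ltr_add_invr; lra.
  exists n; apply/asboolP; exists y; first by rewrite mdistxx.
  move=> u yu; have := metric_triangle u y (first y).
  by rewrite (metric_sym u y); lra.
pose level y := ex_minn (levelP y).
have /choice[center centerP] : forall y, exists x,
    mdist x y < w (level y) /\ deep (level y) x.
  by move=> y; rewrite /level; case: ex_minnP => n /asboolP[x]; exists x.
exists (first \o center); split.
  move=> y; have [cy dc] := centerP y; apply: dc; have := w0 (level y); lra.
move=> z; have [cz _] := centerP z; set n := level z in cz.
(* The first bound keeps [center z] admissible for nearby points, so that their levels are at most
   [n]; the second puts any two of them within [w n]. *)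
pose e := Num.min (w n - mdist (center z) z) (w n / 2).
have e1 : e <= w n - mdist (center z) z by rewrite ge_min lexx.
have e2 : e <= w n / 2 by rewrite ge_min lexx orbT.
have e0 : 0 < e by rewrite lt_min subr_gt0 cz divr_gt0.
have lev u : mdist z u < e -> (level u <= n)%N.
  move=> zu; rewrite {1}/level; case: ex_minnP => i _; apply.
  apply/asboolP; exists (center z); last by case: (centerP z).
  by have := metric_triangle (center z) z u; rewrite /n /= in cz e1 *; lra.
(* Nearby points of equal level have the same image, so each level up to [n] contributes at most one
   value. *)
have same u u' : mdist z u < e -> mdist z u' < e -> level u = level u' ->
    R (first (center u)) (first (center u')) ->
    first (center u) = first (center u').
  move=> zu zu' uu' Ruu'; apply: antiR => //.
  have [cu du] := centerP u; have [cu' _] := centerP u'.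
  have [_] := firstP (center u'); apply; apply: du.
  rewrite -uu' in cu'; have := wle _ _ (lev u zu).
  have := metric_triangle (center u) u (center u').
  have := metric_triangle u u' (center u').
  have := metric_triangle u z u'.
  rewrite (metric_sym u' (center u')) (metric_sym u z); lra.
have /choice[v vP] : forall i : nat, exists v, forall u,
    mdist z u < e -> level u = i -> first (center u) = v.
  move=> i; have [[u [zu ui]]|nou] := pselect (exists u, mdist z u < e /\ level u = i).
    exists (first (center u)) => u' zu' u'i.
    by have [?|?] := totR (first (center u)) (first (center u'));
      [apply/esym|]; apply: same => //; rewrite ui u'i.
  by exists z => u zu ui; case: nou; exists u.
exists [seq v i | i <- iota 0 n.+1], e; split=> // u zu.
by apply/mapP; exists (level u); [rewrite mem_iota ltnS lev|apply: vP].
Qed.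

Lemma within_continuous_mdist (K : realType) (X : metricType K)
    (B : set X) (h : X * K -> X) (y : X) (t e : K) :
  {within B `*` `[0, 1], continuous h} -> B y -> 0 <= t <= 1 -> 0 < e ->
  exists d : K, 0 < d /\ forall y' t', B y' -> 0 <= t' <= 1 ->
    mdist y y' < d -> `|t - t'| < d -> mdist (h (y, t)) (h (y', t')) < e.
Proof.
move=> /subspace_continuousP hc By t01 e0.
have /hc/cvg_ball/(_ _ e0) : (B `*` `[0, 1]) (y, t) by split; rewrite //= in_itv.
rewrite ballEmdist near_withinE => /nbhs_ballP[d /= d0 dh].
exists d; split=> // y' t' By' t'01 yy' tt'.
by apply: (dh (y', t')); [split=> //=; rewrite ballEmdist|split; rewrite //= in_itv].
Qed.

(** * Cutting a homotopy into small steps *)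

Section HomotopySteps.
Context {K : realType} {X : metricType K}.
Variables (B C : set X) (h : X * K -> X) (c0 : X) (good : set X -> Prop).
Hypothesis h_cont : {within B `*` `[0, 1], continuous h}.
Hypothesis h_C : h @` (B `*` `[0, 1]) `<=` C.
Hypothesis h_0 : forall x, B x -> h (x, 0) = x.
Hypothesis h_1 : forall x, B x -> h (x, 1) = c0.
Hypothesis goodS : forall S S', S `<=` S' -> good S' -> good S.
Hypothesis goodC : forall z, C z -> exists e : K, 0 < e /\ good (ball z e).

Let tube y t d : set X := [set u | exists y' t',
  [/\ B y', 0 <= t' <= 1, mdist y y' < d, `|t - t'| < d & u = h (y', t')]].

(** Lebesgue numbers for good sets along the track of [y]; the cap [1] makes their supremum
    [lebesgue y] finite. *)
Let radius y : set K :=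
  [set d | 0 < d <= 1 /\ forall t, 0 <= t <= 1 -> good (tube y t d)].

(** Compactness of the time interval, in its near-covering form, turns a width for each time into
    one width for all times. *)
Let radius_nonempty y : B y -> radius y !=set0.
Proof.
move=> By.
have /compact_near_coveringP/(_ K (0^'+) (fun d t => good (tube y t d)) _) :=
  @segment_compact K 0 1.
case.
  move=> t; rewrite /= in_itv /= => t01.
  have [|e [e0 ge]] := goodC (z := h (y, t)).
    by apply: h_C; exists (y, t) => //; split; rewrite //= in_itv.
  have [d [d0 dh]] := within_continuous_mdist h_cont By t01 e0.
  have d20 : 0 < d / 2 by lra.
  (* One half of [d] allows for moving the center [t], the other for the width of the tube. *)
  exists (ball t (d / 2), [set d' | d' < d / 2]).
    by split; [exact: nbhsx_ballx|exact: nbhs_right_lt].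
  move=> [t' d'] [/= tt' dd']; apply: goodS ge => _ [y' [s [By' s01 yy' t's ->]]].
  rewrite ballEmdist /=; apply: dh => //; first by lra.
  by move: tt'; rewrite /ball /= => tt'; have := ler_distD t' t s; lra.
move=> d0 /= d0_gt0 dP; exists (Num.min (d0 / 2) 1); split.
  by rewrite lt_min ge_min lexx orbT ltr01 !andbT; lra.
move=> t t01; apply: (dP _ _ _ t); rewrite /= ?in_itv //=.
  rewrite sub0r normrN gtr0_norm; first by rewrite gt_min; apply/orP; left; lra.
  by rewrite lt_min ltr01 andbT; lra.
by rewrite lt_min ltr01 andbT; lra.
Qed.

Let lebesgue y : K := sup (radius y).

Let radius_ub y : has_ubound (radius y).
Proof. by exists 1 => d [/andP[]]. Qed.

Let lebesgue_gt0 y : B y -> 0 < lebesgue y.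
Proof.
move=> By; have [d yd] := radius_nonempty By.
by apply: (@lt_le_trans _ _ d); [case: yd => /andP[]|apply: ub_le_sup].
Qed.

(** The tube around [v] of width [d - mdist u v] lies in the tube around [u] of width [d]. *)
Let lebesgue_lipschitz y z : B y -> B z -> `|lebesgue y - lebesgue z| <= mdist y z.
Proof.
suff le u v : B u -> B v -> lebesgue u - mdist u v <= lebesgue v.
  move=> By Bz; rewrite ler_norml; have := le _ _ By Bz; have := le _ _ Bz By.
  by rewrite (metric_sym z y); lra.
move=> Bu Bv; rewrite leNgt; apply/negP => uv.
have [|d [/andP[d0 d1] dP] ud] := sup_gt (radius_nonempty Bu) (x := lebesgue v + mdist u v).
  by rewrite -/(lebesgue u); lra.
have v0 := lebesgue_gt0 Bv; have uv0 := mdist_ge0 u v.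
suff : d - mdist u v <= lebesgue v by lra.
apply: ub_le_sup => //; split; first by apply/andP; split; lra.
move=> t t01; apply: goodS (dP t t01) => _ [y' [s [By' s01 vy' ts ->]]].
by exists y', s; split=> //; [have := metric_triangle u v y'|]; lra.
Qed.

Let speed y := lebesgue y / 4.
Let time j y : K := Num.min 1 (j%:R * speed y).

Let time_itv j y : B y -> 0 <= time j y <= 1.
Proof.
move=> By; rewrite /time ge_min lexx le_min ler01 /= andbT mulr_ge0 //.
by have := lebesgue_gt0 By; rewrite /speed; lra.
Qed.

Lemma homotopy_steps : exists f : nat -> X -> X,
  [/\ forall y, B y -> f 0%N y = y,
      forall j y, B y -> C (f j y) &
      forall z, B z -> exists (e : K) (M : nat), [/\ 0 < e,
        forall y j, B y -> mdist z y < e -> (M <= j)%N -> f j y = c0 &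
        forall j, good [set u | exists y, [/\ B y, mdist z y < e &
          u = f j y \/ u = f j.+1 y]]]].
Proof.
(* The point [y] moves along its track by time steps of length [speed y]; since
   this length depends continuously on [y], nearby points move together, and
   finitely many steps suffice near each point. *)
exists (fun j y => h (y, time j y)); split.
- by move=> y By; rewrite /time mul0r min_r ?ler01 ?h_0.
- move=> j y By; apply: h_C; exists (y, time j y) => //.
  by split=> //=; rewrite in_itv /= time_itv.
move=> z Bz; have z0 := lebesgue_gt0 Bz.
have a0 : 0 < speed z by rewrite /speed; lra.
(* Since [2 * speed z] is half of [lebesgue z], some admissible width exceeds it. This leaves room
   for one time step and for the lag between nearby points. *)
have [d [/andP[d0 d1] dP] zd] :=
  sup_gt (radius_nonempty Bz) (x := 2 * speed z) ltac:(rewrite -/(lebesgue z) /speed; lra).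
(* Near [z] the speed is at least half of [speed z], so [M] steps reach time [1]. *)
pose M := Num.bound (2 / speed z).
have M2 : 2 < M%:R * speed z.
  by rewrite -ltr_pdivrMr //; apply: archi_boundP; apply: divr_ge0 => //; apply: ltW.
have M0 : 0 < M%:R :> K by rewrite -(pmulr_lgt0 _ a0); lra.
have Mi0 : 0 < speed z / M%:R by rewrite divr_gt0.
(* The first bound controls the speed of nearby points, the second the time lag accumulated over
   fewer than [M] steps. *)
pose e := Num.min (speed z) (speed z / M%:R).
have late y j : B y -> mdist z y < e -> (M <= j)%N -> time j y = 1.
  move=> By; rewrite lt_min => /andP[yz _] Mj; rewrite /time min_l //.
  have := lebesgue_lipschitz By Bz; rewrite metric_sym ler_norml /= => /andP[l1 l2].
  apply: (@le_trans _ _ (M%:R * (speed z / 2))); first lra.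
  by apply: ler_pM; rewrite ?ler0n ?ler_nat // /speed in yz *; lra.
have e0 : 0 < e by rewrite lt_min a0.
have close y j : B y -> mdist z y < e -> `|time j z - time j y| <= speed z / 4.
  move=> By yz; have [Mj|jM] := leqP M j.
    by rewrite (late y) ?(late z) ?mdistxx // subrr normr0; lra.
  move: yz; rewrite lt_min => /andP[_]; rewrite ltr_pdivlMr // => yzM.
  have l := lebesgue_lipschitz Bz By.
  apply: (@le_trans _ _ `|j%:R * speed z - j%:R * speed y|).
    set u := _ * _; set v := _ * _; rewrite /time -/u -/v.
    have uv := ler_norm (u - v); have vu := ler_norm (v - u).
    rewrite (distrC v) in vu; rewrite ler_norml.
    by case: (lerP 1 u) => ?; case: (lerP 1 v) => ?; apply/andP; split; lra.
  rewrite -mulrBr normrM ger0_norm ?ler0n //.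
  rewrite /speed -mulrBl normrM (@ger0_norm _ 4^-1) ?invr_ge0 ?ler0n // mulrA.
  rewrite ler_pM2r ?invr_gt0 ?ltr0n // mulrC -/(speed z).
  apply: ltW; apply: le_lt_trans yzM; apply: ler_pM; rewrite ?ler0n //.
  by rewrite ler_nat ltnW.
exists e, M; split=> // [y j By yz Mj|j]; first by rewrite -(h_1 By) late.
apply: goodS (dP (time j z) (time_itv j Bz)) => u [y [By yz uE]].
have c0' := close y j By yz; have c1 := close y j.+1 By yz.
have step : `|time j z - time j.+1 z| <= speed z.
  rewrite /time -natr1 mulrDl mul1r; set v := _ * _.
  by case: (lerP 1 v) => ?; case: (lerP 1 (v + speed z)) => ?; rewrite ler_norml; lra.
have c2 := ler_distD (time j.+1 z) (time j z) (time j.+1 y).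
have yd : mdist z y < d by move: yz; rewrite lt_min => /andP[]; lra.
by case: uE => ->; [exists y, (time j y)|exists y, (time j.+1 y)];
  split; rewrite ?time_itv //; lra.
Qed.

End HomotopySteps.

Lemma eventually0_sum (V : zmodType) (G : nat -> V) (a b : nat) :
  (forall j, (a <= j)%N -> G j = 0) -> (forall j, (b <= j)%N -> G j = 0) ->
  \sum_(j < a) G j = \sum_(j < b) G j.
Proof.
wlog ab : a b / (a <= b)%N => [H Ga Gb|Ga _].
  by have [ab|/ltnW ba] := leqP a b; [apply: H|apply/esym/H].
rewrite -!(big_mkord xpredT G) (big_cat_nat (leq0n a) ab) /=.
rewrite [X in _ + X]big1_seq ?addr0 // => j /=.
by rewrite mem_index_iota => /andP[/Ga].
Qed.

(** The cone over [c0] gives a primitive on [C] that need not vanish on small tuples; subtracting a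
    coboundary built from the contraction repairs this over [B]. *)
Lemma null_homotopic_primitive (K : realType) (X : metricType K)
    (V : zmodType) (B C : set X) (q : nat) (f : seq X -> V) :
  B `<=` C -> null_homotopic_in B C ->
  (forall z, C z -> exists e : K, 0 < e /\ forall y, size y = q.+2 ->
     (forall u, u \in y -> mdist z u < e) -> f y = 0) ->
  (forall y, size y = q.+3 -> (forall u, u \in y -> C u) -> sdiff f y = 0) ->
  exists g : seq X -> V,
    (forall y, size y = q.+2 -> (forall u, u \in y -> B u) -> sdiff g y = f y) /\
    (forall z, B z -> exists e : K, 0 < e /\ forall y, size y = q.+1 ->
       (forall u, u \in y -> B u /\ mdist z u < e) -> g y = 0).
Proof.
move=> BC [c0 [h [Cc0 hcont hC h0 h1]]] f0 df0.
pose good (S : set X) :=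
  forall y, size y = q.+2 -> (forall u, u \in y -> S u) -> f y = 0.
have goodS S S' : S `<=` S' -> good S' -> good S.
  by move=> SS' gS' y sy yS; apply: gS' => // u /yS /SS'.
have goodC z : C z -> exists e : K, 0 < e /\ good (ball z e).
  move=> /f0[e [e0 fe]]; exists e; split=> // y sy ye; apply: fe => // u /ye.
  by rewrite ballEmdist.
have [F [F0 FC Floc]] := homotopy_steps hcont hC h0 h1 goodS goodC.
pose c y := f (c0 :: y).
have dc y : size y = q.+2 -> (forall u, u \in y -> C u) -> sdiff c y = f y.
  move=> sy yC; apply/esym/eqP; rewrite -subr_eq0; apply/eqP.
  by apply: (df0 (c0 :: y)); rewrite /= ?sy // => u /predU1P[->|/yC].
have c_const y : size y = q.+1 -> (forall u, u \in y -> u = c0) -> c y = 0.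
  move=> sy yc; have [e [e0 fe]] := f0 _ Cc0; apply: fe; rewrite /= ?sy //.
  by move=> u /predU1P[->|/yc->]; rewrite mdistxx.
have /choice[N NP] : forall u, exists N, B u -> forall j, (N <= j)%N -> F j u = c0.
  move=> u; have [Bu|] := pselect (B u); last by exists 0%N.
  have [e [N [e0 FN _]]] := Floc u Bu; exists N => _ j; apply: FN => //.
  by rewrite mdistxx.
pose P j := prism (F j.+1) (F j) c.
pose e y := \sum_(j < \max_(u <- y) N u) P j y.
(* Prisms vanish once all tracks have reached [c0], so any later cutoff gives the same sum, and
   nearby tuples can share one [M]. *)
have eE y M : size y = q -> (forall u, u \in y -> B u) ->
    (forall u j, u \in y -> (M <= j)%N -> F j u = c0) -> e y = \sum_(j < M) P j y.
  move=> sy yB yM.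
  have P0 j : (forall u, u \in y -> F j u = c0 /\ F j.+1 u = c0) -> P j y = 0.
    move=> yj; rewrite -(prism0 _ (F j.+1) (F j) y); apply: eq_prism => t st tE.
    by apply: c_const; rewrite ?st ?sy // => v /tE[u /yj[Fj Fj1] [->|->]].
  apply: (@eventually0_sum _ (P^~ y)) => j Mj; apply: P0 => u uy; last first.
    by split; apply: yM; rewrite // ltnW.
  have Nu : (N u <= j)%N by apply: leq_trans Mj; apply: leq_bigmax_seq.
  by split; apply: NP; rewrite ?(leq_trans Nu) //; apply: yB.
(* [c] is a primitive of [f] on [C], and [e] is the locally finite sum of the
   prisms of the homotopy from the identity of [B] to [c0], where [c] vanishes. *)
exists (fun y => c y - sdiff e y); split.
  move=> y sy yB; rewrite sdiffB sdiff_sdiff subr0; apply: dc => // u /yB.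
  exact: BC.
move=> z Bz; have [d [M [d0 FM Fgood]]] := Floc z Bz.
exists d; split=> // y sy yBd.
rewrite (@eq_sdiff _ _ e (fun t => \sum_(j < M) P j t)); last first.
  move=> t st ty; apply: eE.
  - by move: st; rewrite sy => -[].
  - by move=> u /ty/yBd[].
  - by move=> u j /ty/yBd[Bu ud]; apply: FM.
(* The other term of the homotopy formula vanishes: consecutive positions of the tuple lie in a
   common good set, where [sdiff c] equals [f] and [f] is zero. The sum over [j] then telescopes. *)
have dP j : sdiff (P j) y = c (map (F j) y) - c (map (F j.+1) y).
  rewrite -prism_homotopy [X in _ + X](_ : _ = 0) ?addr0 //.
  rewrite -(prism0 _ (F j.+1) (F j) y); apply: eq_prism => t st tE.
  rewrite dc ?st ?sy //; first apply: (Fgood j); rewrite ?st ?sy // => v /tE[u uy vE].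
    by have [Bu ud] := yBd u uy; exists u; split=> //; case: vE; [right|left].
  by have [Bu _] := yBd u uy; case: vE => ->; apply: FC.
have -> : sdiff (fun t => \sum_(j < M) P j t) y = c (map (F 0%N) y) - c (map (F M) y).
  rewrite sdiff_sum; elim: M {FM} => [|M IH]; first by rewrite big_ord0 subrr.
  by rewrite big_ord_recr /= IH dP addrA subrK.
rewrite (_ : map (F 0%N) y = y); last first.
  by rewrite -[RHS]map_id; apply/eq_in_map => u /yBd[Bu _]; apply: F0.
rewrite (c_const (map (F M) y)) ?size_map ?subr0 ?subrr // => _ /mapP[u /yBd[Bu ud] ->].
exact: FM.
Qed.

(** * Bicochains *)

Section Faces.
Context {T : eqType}.

(** A finite list, so that radii depending on the face admit a common lower bound. *)
Definition faces (s : seq T) := [seq take i s ++ drop i.+1 s | i <- iota 0 (size s)].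

Lemma face_size s t : t \in faces s -> (size t).+1 = size s.
Proof.
move=> /mapP[i]; rewrite mem_iota /= add0n => si ->.
by rewrite size_cat size_take si size_drop; lia.
Qed.

Lemma face_subset s t : t \in faces s -> {subset t <= s}.
Proof.
by move=> /mapP[i _ ->] u; rewrite mem_cat => /orP[/mem_take|/mem_drop].
Qed.

Lemma sdiff_faces_eq0 (V : zmodType) (c : seq T -> V) s :
  (forall t, t \in faces s -> c t = 0) -> sdiff c s = 0.
Proof.
move=> c0; rewrite sdiffE big1 // => i _; rewrite c0 ?mul0rz //.
by apply/mapP; exists (val i); rewrite // mem_iota ltn_ord.
Qed.

End Faces.

Lemma common_radius (K : realFieldType) (I : eqType) (l : seq I) (P : I -> K -> Prop) :
  (forall i e e', e <= e' -> P i e' -> P i e) ->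
  (forall i, i \in l -> exists e, 0 < e /\ P i e) ->
  exists e, 0 < e /\ forall i, i \in l -> P i e.
Proof.
move=> Pmono; elim: l => [|i l IH] Pl; first by exists 1.
have [|e [e0 Pe]] := IH; first by move=> j jl; apply: Pl; rewrite inE jl orbT.
have [|d [d0 Pd]] := Pl i; first by rewrite inE eqxx.
exists (Num.min d e); rewrite lt_min d0; split=> // j /predU1P[->|/Pe].
  by apply: Pmono Pd; rewrite ge_min lexx.
by apply: Pmono; rewrite ge_min lexx orbT.
Qed.

Section Bicochains.
Context {K : realType} {X : metricType K} {V : zmodType} (b : X).
Implicit Types (F G : seq X -> seq X -> V) (x y : seq X).

Definition clustered r x := forall u v, u \in x -> v \in x -> mdist u v <= r :> K.
Definition far D x := forall u, u \in x -> D <= mdist b u :> K.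

Lemma clusteredS r r' x x' : {subset x' <= x} -> r <= r' -> clustered r x -> clustered r' x'.
Proof. by move=> sub rr' cx u v /sub ux /sub vx; apply: le_trans (cx u v ux vx) rr'. Qed.

Lemma farS D D' x x' : {subset x' <= x} -> D' <= D -> far D x -> far D' x'.
Proof. by move=> sub DD' fx u /sub ux; apply: le_trans DD' (fx u ux). Qed.

(* For [p = 0], these are the conditions defining the complexes of coarse and of
   boundedly supported cochains. *)
Definition coarsely_zero p q F := forall r, exists D, forall x y,
  size x = p -> size y = q -> clustered r (x ++ y) -> far D (x ++ y) -> F x y = 0.

Definition locally_zero p q F := forall r, exists D, forall x z,
  size x = p -> clustered r (z :: x) -> far D (z :: x) ->
  exists e, 0 < e /\ forall y, size y = q ->
    (forall u, u \in y -> mdist z u < e) -> F x y = 0.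

Definition dl F x y := sdiff (F^~ y) x.
Definition dr F x y := sdiff (F x) y.

Lemma dl_dl F x y : dl (dl F) x y = 0.
Proof. exact: sdiff_sdiff. Qed.

Lemma dr_dr F x y : dr (dr F) x y = 0.
Proof. exact: sdiff_sdiff. Qed.

Lemma dl_dr F x y : dl (dr F) x y = dr (dl F) x y.
Proof. exact: sdiffC. Qed.

Lemma dlB F G x y : dl (fun x y => F x y - G x y) x y = dl F x y - dl G x y.
Proof. exact: sdiffB. Qed.

Lemma drB F G x y : dr (fun x y => F x y - G x y) x y = dr F x y - dr G x y.
Proof. exact: sdiffB. Qed.

Lemma eq_coarsely_zero p q F G : (forall x y, F x y = G x y) ->
  coarsely_zero p q F -> coarsely_zero p q G.
Proof.
by move=> FG F0 r; have [D FD] := F0 r; exists D => x y *; rewrite -FG FD.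
Qed.

Lemma coarsely_zero0 p q : coarsely_zero p q (fun _ _ => 0).
Proof. by move=> r; exists 0. Qed.

Lemma coarsely_zeroB p q F G : coarsely_zero p q F -> coarsely_zero p q G ->
  coarsely_zero p q (fun x y => F x y - G x y).
Proof.
move=> F0 G0 r; have [D FD] := F0 r; have [E GE] := G0 r.
exists (Num.max D E) => x y sx sy cxy fxy.
by rewrite FD ?GE ?subrr //; apply: farS fxy => //; rewrite le_max lexx ?orbT.
Qed.

Lemma coarsely_zeroD p q F G : coarsely_zero p q F -> coarsely_zero p q G ->
  coarsely_zero p q (fun x y => F x y + G x y).
Proof.
move=> F0 G0; have := coarsely_zeroB F0 (coarsely_zeroB (coarsely_zero0 p q) G0).
by apply: eq_coarsely_zero => x y; rewrite sub0r opprK.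
Qed.

Lemma coarsely_zero_dr p q F : coarsely_zero p q F -> coarsely_zero p q.+1 (dr F).
Proof.
move=> F0 r; have [D FD] := F0 r; exists D => x y sx sy cxy fxy.
apply: sdiff_eq0 => t; rewrite sy => -[st] ty; apply: FD => //.
  by apply: clusteredS cxy => // u; rewrite !mem_cat => /orP[->//|/ty->]; rewrite orbT.
by apply: farS fxy => // u; rewrite !mem_cat => /orP[->//|/ty->]; rewrite orbT.
Qed.

Lemma coarsely_zero_dl p q F : coarsely_zero p q F -> coarsely_zero p.+1 q (dl F).
Proof.
move=> F0 r; have [D FD] := F0 r; exists D => x y sx sy cxy fxy.
apply: sdiff_eq0 => t; rewrite sx => -[st] tx.
have txy : {subset t ++ y <= x ++ y}.
  by move=> u; rewrite !mem_cat => /orP[/tx->//|->]; rewrite orbT.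
by apply: FD => //; [apply: clusteredS cxy|apply: farS fxy].
Qed.

Lemma locally_zeroB p q F G : locally_zero p q F -> locally_zero p q G ->
  locally_zero p q (fun x y => F x y - G x y).
Proof.
move=> F0 G0 r; have [D FD] := F0 r; have [E GE] := G0 r.
exists (Num.max D E) => x z sx cx fx.
have [|d [d0 Fd]] := FD x z sx cx.
  by apply: farS fx => //; rewrite le_max lexx.
have [|e [e0 Ge]] := GE x z sx cx.
  by apply: farS fx => //; rewrite le_max lexx orbT.
exists (Num.min d e); rewrite lt_min d0; split=> // y sy yde.
by rewrite Fd ?Ge ?subrr // => u /yde; rewrite lt_min => /andP[].
Qed.

Lemma locally_zero_dr p q F : locally_zero p q F -> locally_zero p q.+1 (dr F).
Proof.
move=> F0 r; have [D FD] := F0 r; exists D => x z sx cx fx.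
have [e [e0 Fe]] := FD x z sx cx fx; exists e; split=> // y sy ye.
by apply: sdiff_eq0 => t; rewrite sy => -[st] ty; apply: Fe => // u /ty/ye.
Qed.

Lemma locally_zero_dl p q F : locally_zero p q F -> locally_zero p.+1 q (dl F).
Proof.
move=> F0 r; have [D FD] := F0 r; exists D => x z sx cx fx.
have [|i|e [e0 Fe]] := @common_radius K _ (faces x) (fun t e => forall y,
    size y = q -> (forall u, u \in y -> mdist z u < e) -> F t y = 0).
- by move=> t e e' ee' Fe' y sy ye; apply: Fe' => // u /ye; move/lt_le_trans; apply.
- move=> /[dup]/face_subset it /face_size; rewrite sx => -[si]; apply: FD => //.
    by apply: clusteredS cx => // u; rewrite !inE => /orP[->//|/it->]; rewrite orbT.
  by apply: farS fx => // u; rewrite !inE => /orP[->//|/it->]; rewrite orbT.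
by exists e; split=> // y sy ye; apply: sdiff_faces_eq0 => t /Fe; apply.
Qed.

(** A tuple [y] with a single entry [z] lies in every neighborhood of [z]. This ends the zigzag. *)
Lemma locally_zero_size1 p F : locally_zero p 1 F -> coarsely_zero p 1 F.
Proof.
move=> F0 r; have [D FD] := F0 r; exists D => x [|z []] // sx _ cx fx.
have zx : {subset z :: x <= x ++ [:: z]}.
  by move=> u; rewrite mem_cat !inE orbC.
have [e [e0 Fe]] := FD x z sx (clusteredS zx (lexx r) cx) (farS zx (lexx D) fx).
by apply: Fe => // u; rewrite inE => /eqP->; rewrite mdistxx.
Qed.

Lemma coned_primitive p q F :
  locally_zero p.+1 q.+1 F -> coarsely_zero p.+2 q.+1 (dl F) ->
  exists G, locally_zero p q.+1 G /\
    coarsely_zero p.+1 q.+1 (fun x y => F x y - dl G x y).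
Proof.
(* The retraction [pi] takes finitely many values near each point, so that the
   cochains [F (pi u :: x)], for [u] near this point, vanish on tuples of points
   of a common neighborhood. *)
move=> F0 dF0; have [pi [pi1 piF]] := locally_finite_retraction X.
exists (fun x y => if y is u :: _ then F (pi u :: x) y else 0); split.
  (* The vertex [pi u] is within [1] of [u], itself within [1] of [z]; hence the two shifts by [2].
     The absolute value keeps the bound nonnegative. *)
  move=> r; have [D FD] := F0 (`|r| + 2); exists (D + 2) => x z sx cx fx.
  have [l [e [e0 le]]] := piF z.
  have [|w|d [d0 Fd]] := @common_radius K _ [seq w <- l | `[< mdist z w < 2 >]] (fun w e =>
    forall y, size y = q.+1 -> (forall u, u \in y -> mdist z u < e) -> F (w :: x) y = 0).
  - by move=> t d d' dd' Fd' y sy ye; apply: Fd' => // u /ye; move/lt_le_trans; apply.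
  - rewrite mem_filter => /andP[/asboolP zw _]; apply: FD; first by rewrite /= sx.
      have r1 := ler_norm r.
      have zx u : u \in z :: x -> mdist z u <= `|r|.
        by move=> ux; apply: le_trans r1; apply: cx; rewrite ?inE ?eqxx.
      have wx u : u \in z :: x -> mdist w u <= `|r| + 2.
        move=> ux; have := zx u ux; have := metric_triangle w z u.
        by rewrite (metric_sym w z); lra.
      have in3 u : u \in [:: z, w & x] -> u = w \/ u \in z :: x.
        by rewrite !inE => /or3P[->|/eqP->|->]; rewrite ?orbT; [right|left|right].
      move=> u v /in3[->|ux] /in3[->|vx].
      + by rewrite mdistxx; have := normr_ge0 r; lra.
      + exact: wx.
      + by rewrite metric_sym; apply: wx.
      + by have := cx u v ux vx; lra.
    have far2 u : u \in z :: x -> D + 2 <= mdist b u by apply: fx.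
    move=> u; rewrite !inE => /or3P[/eqP->|/eqP->|ux].
    + by have := far2 z; rewrite inE eqxx => /(_ isT); lra.
    + have := far2 z; rewrite inE eqxx => /(_ isT).
      by have := metric_triangle b w z; rewrite (metric_sym w z); lra.
    + by have := far2 u; rewrite inE ux orbT => /(_ isT); lra.
  exists (Num.min d (Num.min e 1)); split; first by rewrite !lt_min d0 e0 ltr01.
  move=> [|u y] // sy yd.
  have := yd u; rewrite inE eqxx => /(_ isT); rewrite !lt_min => /and3P[_ ue u1].
  apply: (Fd (pi u)) => // [|v /yd]; last by rewrite lt_min => /andP[].
  rewrite mem_filter le // andbT; apply/asboolP.
  by have := metric_triangle z u (pi u); have := pi1 u; lra.
(* Here [F x y - dl G x y] unfolds to [dl F (pi u :: x) y], with [pi u] within [1] of the entry [u]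
   of [y]. *)
move=> r; have [D FD] := dF0 (`|r| + 1); exists (D + 1) => x [|u y] // sx sy cxy fxy.
apply: (FD (pi u :: x) (u :: y)); rewrite /= ?sx //.
  have r1 := ler_norm r.
  have wx v : v \in x ++ u :: y -> mdist (pi u) v <= `|r| + 1.
    move=> vx; have := cxy u v; rewrite vx mem_cat inE eqxx orbT => /(_ isT isT).
    have := pi1 u; rewrite (metric_sym u (pi u)).
    by have := metric_triangle (pi u) u v; lra.
  move=> v w; rewrite !inE => /predU1P[->|vx] /predU1P[->|wx'].
  - by rewrite mdistxx; have := normr_ge0 r; lra.
  - exact: wx.
  - by rewrite metric_sym; apply: wx.
  - by have := cxy v w vx wx'; lra.
move=> v; rewrite inE => /predU1P[->|vx]; last by have := fxy v vx; lra.
have := fxy u; rewrite mem_cat inE eqxx orbT => /(_ isT).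
have := pi1 u; have := metric_triangle b (pi u) u.
by rewrite (metric_sym (pi u) u); lra.
Qed.

End Bicochains.

(** A ball of radius [k] has some diameter at most [2 k], not known exactly; monotonicity of [rho]
    and [mu] gives bounds depending on [k] only. *)
Lemma contractible_balls (K : realType) (X : metricType K) :
  unif_contractible_at_infinity X -> exists b : X, forall k : K, 0 <= k ->
    exists rho D : K, forall x, D <= mdist b x -> exists C : set X,
      [/\ [set u | mdist x u <= k] `<=` C,
          forall u v, C u -> C v -> mdist u v <= rho &
          null_homotopic_in [set u | mdist x u <= k] C].
Proof.
move=> [rho [mu [b [rho_mono mu_mono contr]]]]; exists b => k k0.
have k20 : 0 <= k + k by lra.
pose r := NngNum k20.
exists (rho r)%:num, ((mu r)%:num + k) => x xD; set B := [set u | _].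
have Bx : B x by rewrite /B /= mdistxx.
have d0 : (0 <= diameter B)%E.
  by apply: ereal_sup_ubound; exists x => //; exists x => //; rewrite mdistxx.
have dk : (diameter B <= (k + k)%:E)%E.
  apply: ge_ereal_sup => _ [u Bu [v Bv <-]]; rewrite lee_fin.
  by have := metric_triangle u x v; rewrite (metric_sym u x) /B /= in Bu Bv *; lra.
have dfin : diameter B \is a fin_num.
  by rewrite ge0_fin_numE //; apply: le_lt_trans dk _; rewrite ltry.
have s0 : 0 <= fine (diameter B) by apply: fine_ge0.
pose s := NngNum s0.
have sr : s <= r.
  by rewrite -num_le /= -lee_fin fineK.
have [||C [dC [BC hC]]] := contr s B.
- by rewrite /= fineK.
- apply: le_ereal_inf_tmp => _ [u Bu <-]; rewrite lee_fin.
  have : (mu s)%:num <= (mu r)%:num by rewrite num_le; apply: mu_mono.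
  by have := metric_triangle b u x; rewrite (metric_sym u x) /B /= in Bu *; lra.
exists C; split=> // u v Cu Cv; rewrite -lee_fin.
apply: (@le_trans _ _ (diameter C)).
  by apply: ereal_sup_ubound; exists u => //; exists v.
by apply: le_trans dC _; rewrite lee_fin num_le; apply: rho_mono.
Qed.

(** * Exactness in the second tuple, and the zigzag *)

Section ContractibleResolution.
Context {K : realType} {X : metricType K} {V : zmodType} (b : X).
Hypothesis contr : forall k : K, 0 <= k ->
  exists rho D : K, forall x, D <= mdist b x -> exists C : set X,
    [/\ [set u | mdist x u <= k] `<=` C,
        forall u v, C u -> C v -> mdist u v <= rho &
        null_homotopic_in [set u | mdist x u <= k] C].
Implicit Types F G : seq X -> seq X -> V.

(** The ball is centered at the first entry of [x]; [b] is the default value of [head]. *)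
Let primitive_upto q F x (k : K) (g : seq X -> V) :=
  (forall y, size y = q.+2 -> (forall u, u \in y -> mdist (head b x) u <= k) ->
     sdiff g y = F x y) /\
  (forall z, mdist (head b x) z <= k -> exists e, 0 < e /\ forall y,
     size y = q.+1 -> (forall u, u \in y -> mdist z u < e) -> g y = 0).

(** For each radius [k], [F x] has a primitive on the ball of radius [k] once [x] is far enough, but
    a single [G] must serve all radii. So [G x] is taken on the largest ball possible. *)
Lemma contracted_primitive p q F :
  locally_zero b p.+1 q.+2 F -> coarsely_zero b p.+1 q.+3 (dr F) ->
  exists G, locally_zero b p.+1 q.+1 G /\
    coarsely_zero b p.+1 q.+2 (fun x y => F x y - dr G x y).
Proof.
move=> F0 dF0.
have local k : 0 <= k -> exists D, forall x, size x = p.+1 -> clustered k x ->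
    far b D x -> exists g, primitive_upto q F x k g.
  (* The margin [1] keeps small tuples near a point of the ball of radius [k] inside the contracted
     ball. *)
  move=> k0; have [|rho [D1 contr1]] := contr (k := k + 1); first lra.
  (* The set [C] has diameter at most [rho] and contains [x0], which is within [k] of all of [x]. *)
  have [D2 F2] := F0 (rho + k); have [D3 dF3] := dF0 (rho + k).
  exists (Num.max D1 (Num.max (D2 + rho) (D3 + rho))) => -[|x0 x] // sx cx fx.
  have := fx x0; rewrite inE eqxx => /(_ isT); rewrite !ge_max => /and3P[x1 x2 x3].
  have [C [BC diamC null]] := contr1 x0 x1.
  have Cx0 : C x0 by apply: BC; rewrite /= mdistxx; lra.
  have rho0 : 0 <= rho by rewrite -(mdistxx x0); apply: diamC.
  have Cx u v : C u -> v \in x0 :: x -> mdist u v <= rho + k.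
    move=> Cu vx; have := cx x0 v; rewrite inE eqxx => /(_ isT vx).
    by have := diamC u x0 Cu Cx0; have := metric_triangle u x0 v; lra.
  have closeC y : (forall u, u \in y -> C u) -> clustered (rho + k) (x0 :: x ++ y).
    have in2 u : u \in x0 :: x ++ y -> u \in x0 :: x \/ u \in y.
      by rewrite -cat_cons mem_cat => /orP.
    move=> yC u v /in2[ux|/yC uy] /in2[vx|/yC vy].
    - by have := cx u v ux vx; lra.
    - by rewrite metric_sym; apply: Cx.
    - exact: Cx.
    - by have := diamC u v uy vy; lra.
  have farC D y : D + rho <= mdist b x0 ->
      D + rho <= Num.max D1 (Num.max (D2 + rho) (D3 + rho)) ->
      (forall u, u \in y -> C u) -> far b D (x0 :: x ++ y).
    move=> Dx0 Dmax yC u; rewrite -cat_cons mem_cat => /orP[/fx ux|/yC uC].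
      by apply: le_trans ux; apply: le_trans Dmax; lra.
    by have := diamC u x0 uC Cx0; have := metric_triangle b u x0; lra.
  have D2m : D2 + rho <= Num.max D1 (Num.max (D2 + rho) (D3 + rho)).
    by rewrite !le_max lexx orbT.
  have D3m : D3 + rho <= Num.max D1 (Num.max (D2 + rho) (D3 + rho)).
    by rewrite !le_max lexx !orbT.
  have [||g [dg g0]] := @null_homotopic_primitive K X V _ C q (F (x0 :: x)) BC null.
  - move=> z Cz; have zx : {subset z :: x0 :: x <= x0 :: x ++ [:: z]}.
      by move=> u; rewrite -cat_cons mem_cat mem_seq1 orbC -in_cons.
    have zC u : u \in [:: z] -> C u by rewrite inE => /eqP->.
    apply: F2 => //; first exact: clusteredS zx (lexx _) (closeC _ zC).
    exact: farS zx (lexx _) (farC _ _ x2 D2m zC).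
  - move=> y sy yC; apply: (dF3 (x0 :: x) y) => //; first exact: closeC.
    exact: farC.
  exists g; split=> [y sy yk|z zk].
    by apply: dg => // u /yk /=; lra.
  have [|e [e0 ge]] := g0 z; first by move: zk => /=; lra.
  exists (Num.min e 1); rewrite lt_min e0 ltr01; split=> // y sy ye.
  apply: ge => // u /ye; rewrite lt_min => /andP[ue u1]; split=> //=.
  by have := metric_triangle x0 z u; move: zk => /=; lra.
have mono x k k' g : k <= k' -> primitive_upto q F x k' g -> primitive_upto q F x k g.
  move=> kk' [dg g0]; split=> [y sy yk|z zk]; last by apply: g0; apply: le_trans kk'.
  by apply: dg => // u /yk uk; apply: le_trans kk'.
(* Bounding the integer radius [k] by the distance to [b] leaves finitely many candidates; a
   primitive for the largest one restricts to all smaller ones. *)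
have /choice[G GP] : forall x, exists g, forall k : nat, k%:R <= mdist b (head b x) ->
    (exists g', primitive_upto q F x k%:R g') -> primitive_upto q F x k%:R g.
  move=> x; pose N := Num.bound (mdist b (head b x)).
  have NP : mdist b (head b x) < N%:R by apply: archi_boundP; apply: mdist_ge0.
  suff [g gP] : exists g, forall k, (k <= N)%N ->
      (exists g', primitive_upto q F x k%:R g') -> primitive_upto q F x k%:R g.
    exists g => k kx; apply: gP; rewrite ltnW // -(ltr_nat K).
    exact: le_lt_trans NP.
  elim: N {NP} => [|N [g gN]].
    have [[g g0]|no] := pselect (exists g, primitive_upto q F x 0%:R g).
      by exists g => k; rewrite leqn0 => /eqP->.
    by exists (fun=> 0) => k; rewrite leqn0 => /eqP-> /no.
  have [[g' g'N]|no] := pselect (exists g, primitive_upto q F x N.+1%:R g).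
    by exists g' => k kN _; apply: mono g'N; rewrite ler_nat.
  exists g => k; rewrite leq_eqVlt ltnS => /predU1P[->/no//|kN]; exact: gN.
have Gspec r : exists D, exists2 k : K, r <= k &
    forall x, size x = p.+1 -> clustered r x -> far b D x -> primitive_upto q F x k (G x).
  pose k := Num.bound `|r|; have rk : r <= k%:R.
    by apply: le_trans (ler_norm r) (ltW _); apply: archi_boundP.
  have [D DP] := local _ (ler0n K k).
  (* Beyond distance [k] from [b], the radius [k] is among the candidates. *)
  exists (Num.max D k%:R), k%:R => // x sx cx fx; apply: GP.
    have : head b x \in x by case: (x) sx => // u x' _; rewrite inE eqxx.
    by move/fx; rewrite ge_max => /andP[].
  apply: DP => //; first exact: clusteredS cx.
  by apply: farS fx => //; rewrite le_max lexx.
have headP x : size x = p.+1 -> head b x \in x.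
  by case: x => // u x' _; rewrite inE eqxx.
exists G; split=> r; have [D [k rk GD]] := Gspec r; exists D.
  move=> x z sx cx fx; have zx : {subset x <= z :: x}.
    by move=> u ux; rewrite inE ux orbT.
  have [|_] := GD x sx _ (farS zx (lexx D) fx); first exact: clusteredS cx.
  by apply; apply: le_trans rk; apply: cx; rewrite inE ?eqxx ?headP ?orbT.
move=> x y sx sy cx fx; have xy : {subset x <= x ++ y}.
  by move=> u ux; rewrite mem_cat ux.
have [|dG _] := GD x sx _ (farS xy (lexx D) fx); first exact: clusteredS cx.
rewrite /dr dG ?subrr // => u uy; apply: le_trans rk.
by apply: cx; rewrite mem_cat ?headP ?uy ?orbT.
Qed.

Lemma bicomplex_zigzag q p F :
  locally_zero b p q.+2 F -> coarsely_zero b p.+1 q.+3 (dl (dr F)) ->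
  exists G, locally_zero b p q.+1 G /\
    coarsely_zero b p.+1 q.+2 (dl (fun x y => F x y - dr G x y)).
Proof.
(* [lam] is a right primitive of [dl F]; the induction hypothesis corrects it
   into a left cocycle, and [G] is a left primitive of the latter. *)
elim: q p F => [|q IH] p F F0 dF0.
  (* Here [lam] has one entry on the right, so it is already coarsely zero, hence so is [dl F], and
     [G = 0] works. *)
  have [lam [/locally_zero_size1 lam0 Flam]] := contracted_primitive
    (locally_zero_dl F0) (eq_coarsely_zero (dl_dr F) dF0).
  exists (fun _ _ => 0); split; first by move=> r; exists 0 => x z *; exists 1.
  have := coarsely_zeroD Flam (coarsely_zero_dr lam0).
  by apply: eq_coarsely_zero => x y; rewrite subrK dlB dl_dr /dr /dl !sdiff0 subr0.
have [lam [lam0 Flam]] := contracted_primitive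
  (locally_zero_dl F0) (eq_coarsely_zero (dl_dr F) dF0).
have [|kap [kap0 lamkap]] := IH p.+1 lam lam0.
  (* Since [dl (dl F) = 0], the cochain [dl (dr lam)] is minus [dl] of the coarsely zero
     [dl F - dr lam]. *)
  have := coarsely_zero_dl Flam; move/(coarsely_zeroB (coarsely_zero0 b p.+2 q.+3)).
  by apply: eq_coarsely_zero => x y; rewrite dlB dl_dl !sub0r opprK.
have [G [G0 lamG]] := coned_primitive (locally_zeroB lam0 (locally_zero_dr kap0)) lamkap.
(* Applying [dr] to [lam - dr kap - dl G] kills [kap]; adding [dl F - dr lam] leaves
   [dl (F - dr G)]. *)
exists G; split=> //; have := coarsely_zeroD Flam (coarsely_zero_dr lamG).
apply: eq_coarsely_zero => x y.
by rewrite !drB dr_dr subr0 dlB dl_dr addrA subrK.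
Qed.

End ContractibleResolution.

(** * Comparison of the complexes *)

Section PointwiseNeighborhoods.
Context {K : realType} {X : metricType K} (n : nat).

Lemma nbhs_box (z : X) (e : K) : 0 < e ->
  nbhs (cst z : {ptws 'I_n -> X}) [set s : 'I_n -> X | forall i, mdist z (s i) < e].
Proof.
move=> e0; apply: (@filter_forall {ptws 'I_n -> X} 'I_n
  (fun i s => mdist z (s i) < e) _ (nbhs_filter _)) => i.
have /(_ (cst z) (ball z e)) : continuous (fun s : {ptws 'I_n -> X} => s i).
  exact: (@proj_continuous _ (fun=> X) i).
move=> /(_ (nbhsx_ballx _ _ e0)).
by rewrite ballEmdist; apply: (@filterS _ (nbhs (cst z : {ptws 'I_n -> X}))).
Qed.

(** The filter generated by the boxes converges to [cst z], which can be tested coordinatewise. *)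
Lemma box_subset_nbhs (z : X) (W : set {ptws 'I_n -> X}) :
  nbhs (cst z : {ptws 'I_n -> X}) W ->
  exists e : K, 0 < e /\ forall s : 'I_n -> X, (forall i, mdist z (s i) < e) -> W s.
Proof.
pose F : set_system {ptws 'I_n -> X} := filter_from [set e : K | 0 < e]
  (fun e => [set s : 'I_n -> X | forall i, mdist z (s i) < e]).
have FF : Filter F.
  apply: filter_from_filter; first by exists 1; rewrite /= ltr01.
  move=> d e /= d0 e0; exists (Num.min d e) => /=; first by rewrite lt_min d0.
  by move=> s sde; split=> i; have := sde i; rewrite lt_min => /andP[].
suff Fz : F --> (cst z : {ptws 'I_n -> X}).
  by move=> /Fz[e /= e0 eW]; exists e; split=> // s /eW.
apply/cvg_sup => i U [V [[W' oW' <-] zW' WU]].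
have /nbhs_ballP[e /= e0 eW'] : nbhs z W' by apply: open_nbhs_nbhs.
exists e => //= s se; apply: WU; apply: (eW' (s i)).
by rewrite ballEmdist; apply: se.
Qed.

End PointwiseNeighborhoods.

(** * Support conditions in terms of tuples *)

Section CochainsOfTuples.
Context {K : realType} {X : metricType K} {A : pzRingType} (b : X).

(** Meaningful on sequences of size [n.+1]; [b] is the default value of [nth]. *)
Definition seq_cochain n (phi : cochain X A n) (s : seq X) : A :=
  phi (fun i : 'I_n.+1 => nth b s i).

Lemma nth_codom_ord n (s : 'I_n -> X) (i : 'I_n) : nth b (codom s) i = s i.
Proof. by rewrite /codom /image_mem (nth_map i) ?size_enum_ord // nth_ord_enum. Qed.

Lemma seq_cochain_codom n (phi : cochain X A n) (s : 'I_n.+1 -> X) :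
  seq_cochain phi (codom s) = phi s.
Proof. by congr phi; apply/funext => i; rewrite nth_codom_ord. Qed.

Lemma seq_cochain_codiff n (phi : cochain X A n) (s : seq X) :
  size s = n.+2 -> seq_cochain (codiff phi) s = sdiff (seq_cochain phi) s.
Proof.
move=> ss; rewrite sdiffE ss; apply: eq_bigr => i _.
rewrite -mulrzl rmorphXn rmorphN1; congr (_ * phi _); apply/funext => j /=.
rewrite nth_cat size_take ss ltn_ord nth_drop /bump.
have [ij|ji] := leqP i j; last by rewrite add0n nth_take.
by rewrite add1n addSn subnKC.
Qed.

(** Clustered tuples are those near the diagonal: entries within [r] of a common point are within
    [2 r] of each other, and conversely the first entry gives a nearby diagonal point. *)
Lemma coarseP n (phi : cochain X A n) :
  phi \in @coarse K X A n <-> coarsely_zero b 0 n.+1 (fun _ => seq_cochain phi).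
Proof.
split=> [/asboolP cphi r|phi0].
  (* The neighborhood is defined by a strict inequality, and [r] may be negative. *)
  have [M phiM] := cphi (`|r| + 1).
  have inS y : size y = n.+1 -> clustered r y -> seq_cochain phi y <> 0 ->
      (seq_support phi `&` neighborhood (`|r| + 1) diagonal_seq)
        (stutter (fun i : 'I_n.+1 => nth b y i)).
    move=> sy cy phiy; split; first by exists (fun i : 'I_n.+1 => nth b y i).
    split; first exact: eventually_constant_stutter.
    exists (stutter (fun _ : 'I_1 => nth b y 0)); first by exists (fun=> nth b y 0).
    apply: (@le_lt_trans _ _ `|r|); last by rewrite ltrDl.
    apply: (sup_dist_le 0%N) => k; apply: le_trans (ler_norm r).
    by apply: cy; apply: mem_nth; rewrite sy.
  have [S0|/set0P[s0 Ss0]] := eqVneq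
      (seq_support phi `&` neighborhood (`|r| + 1) diagonal_seq) set0.
    exists 0 => -[|//] y _ sy cy _; apply: contrapT => phiy.
    by have := inS y sy cy phiy; rewrite S0.
  exists (mdist b (s0 0%N) + M + 1) => -[|//] y _ sy cy fy; apply: contrapT => phiy.
  have Sy := inS y sy cy phiy; have := phiM _ _ Ss0 Sy.
  have fin : finite_dist s0 (stutter (fun i : 'I_n.+1 => nth b y i)).
    by apply: finite_dist_eventually_constant; [case: Ss0 => _ []|case: Sy => _ []].
  have := mdist_sup_dist 0%N fin.
  rewrite {1}/stutter min0n inordK // => d1 d2.
  have := fy (nth b y 0); rewrite mem_nth ?sy // => /(_ isT).
  by have := metric_triangle b (s0 0%N) (nth b y 0); lra.
apply/asboolP => r; have [D phiD] := phi0 (r + r).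
have bounded x : (seq_support phi `&` neighborhood r diagonal_seq) x ->
    forall k, mdist b (x k) <= D + (r + r).
  move=> [[s /= phis <-] [_ [_ [p _ <-] sp]]] k.
  have fin : finite_dist (@stutter K X n s) (@stutter K X 0 p).
    by apply: finite_dist_eventually_constant; apply: eventually_constant_stutter.
  have sip i : mdist (s i) (p ord0) < r.
    apply: le_lt_trans sp; have := mdist_sup_dist (val i) fin.
    rewrite {1}/stutter (minn_idPl _) ?inord_val; last exact: (ltn_ord i).
    by rewrite /stutter (ord1 (inord _)).
  have sij i j : mdist (s i) (s j) <= r + r.
    have := metric_triangle (s i) (p ord0) (s j); rewrite (metric_sym (p ord0)).
    by have := sip i; have := sip j; lra.
  have [i siD] : exists i, mdist b (s i) < D.
    apply: contrapT => /forallNP farD; apply: phis.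
    rewrite -seq_cochain_codom; apply: (phiD [::]); rewrite /= ?size_codom ?card_ord //.
      by move=> _ _ /codomP[i ->] /codomP[j ->].
    by move=> _ /codomP[i ->]; rewrite leNgt; apply/negP/farD.
  have := metric_triangle b (s i) (stutter s k).
  by have := sij i (inord (minn k n)); rewrite -/(stutter s k); lra.
exists (D + (r + r) + (D + (r + r))) => x y /bounded bx /bounded by'.
apply: (sup_dist_le 0%N) => k.
have := metric_triangle (x k) b (y k); rewrite (metric_sym (x k) b).
by have := bx k; have := by' k; lra.
Qed.

(** A diagonal point avoids the closure of the support exactly when the cochain vanishes on a box
    around it. *)
Lemma bsuppP n (phi : cochain X A n) :
  phi \in @bsupp K X A n <-> locally_zero b 0 n.+1 (fun _ => seq_cochain phi).
Proof.
split=> [/asboolP[M phiM] r|phi0].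
  have [D DP] : exists D, forall z, D <= mdist b z -> ~ diag_support phi (cst z).
    have [[p0 p0P]|no] := pselect (exists p, diag_support phi (cst p)).
      exists (mdist b p0 + M + 1) => z zD zP.
      have := @mdist_sup_dist _ _ _ (cst p0) (cst z) (ord0 : 'I_n.+1) (finite_dist_ord _ _).
      have := phiM _ _ p0P zP; have := metric_triangle b p0 z.
      by rewrite /cst /=; lra.
    by exists 0 => z _ zP; apply: no; exists z.
  exists D => -[|//] z _ _ fz.
  have /DP nz : D <= mdist b z by apply: fz; rewrite inE.
  have [W [Wz W0]] : exists W, nbhs (cst z : {ptws 'I_n.+1 -> X}) W /\
      coch_support phi `&` W = set0.
    apply: contrapT => no; apply: nz; split; first by exists z.
    move=> W Wz; apply/set0P/eqP => W0; apply: no; exists W; split=> //.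
  have [e [e0 eW]] := box_subset_nbhs Wz; exists e; split=> // y sy ye.
  apply: contrapT => phiy.
  suff : (coch_support phi `&` W) (fun i : 'I_n.+1 => nth b y i) by rewrite W0.
  by split=> //; apply: eW => i; apply: ye; rewrite mem_nth ?sy.
(* Radius [0] suffices, as [z] alone has to be clustered when [x] is empty. *)
apply/asboolP; have [D phiD] := phi0 0; exists (D + D).
have bounded p : diag_support phi (cst p) -> mdist b p < D.
  move=> [_ clp]; rewrite ltNge; apply/negP => Dp.
  have [||e [e0 phie]] := phiD [::] p erefl.
  - by move=> u v; rewrite !mem_seq1 => /eqP-> /eqP->; rewrite mdistxx.
  - by move=> u; rewrite mem_seq1 => /eqP->.
  have [s [sphi se]] := clp _ (@nbhs_box K X n.+1 p e e0); apply: sphi.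
  rewrite -seq_cochain_codom; apply: phie; first by rewrite size_codom card_ord.
  by move=> _ /codomP[i ->].
move=> _ _ [[p _ <-] clp] [[q _ <-] clq]; apply: (sup_dist_le ord0) => k.
have bp : mdist b p < D by apply: bounded; split=> //; exists p.
have bq : mdist b q < D by apply: bounded; split=> //; exists q.
by have := metric_triangle p b q; rewrite (metric_sym p b) /cst; lra.
Qed.

End CochainsOfTuples.

(** Tuples in a ball of radius [1/2] around a far point are clustered with bound [1], and far. *)
Lemma coarse_bsupp (K : realType) (X : metricType K) (A : pzRingType) n
    (phi : cochain X A n) :
  phi \in @coarse K X A n -> phi \in @bsupp K X A n.
Proof.
have [b|noX] := pselect (inhabited X); last first.
  by move=> _; apply/asboolP; exists 0 => x; case: noX; exists; apply: (x ord0).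
case: b => b /(coarseP b) phi0; apply/(bsuppP b) => r.
have [D phiD] := phi0 1; exists (D + 1) => -[|//] z _ _ fz.
exists 2^-1; split; first lra.
move=> y sy ye; apply: (phiD [::]) => // [u v /ye zu /ye zv|u /ye zu].
  by have := metric_triangle u z v; rewrite (metric_sym u z); lra.
have := metric_triangle b u z; rewrite (metric_sym u z).
by have : D + 1 <= mdist b z; [apply: fz; rewrite inE|lra].
Qed.

Lemma bsupp_coarse_degree0 (K : realType) (X : metricType K) (A : pzRingType)
    (psi : cochain X A 0) (b : X) :
  psi \in @bsupp K X A 0 -> psi \in @coarse K X A 0.
Proof. by move=> /(bsuppP b)/locally_zero_size1/(coarseP b). Qed.

(** The zigzag with [p = 0], started at [psi] viewed as constant in [x]; on a single entry, [dl]
    evaluates at the empty tuple. *)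
Lemma bsupp_coarse_correction (K : realType) (X : metricType K) (A : pzRingType) n
    (psi : cochain X A n.+1) :
  unif_contractible_at_infinity X -> psi \in @bsupp K X A n.+1 ->
  codiff psi \in @coarse K X A n.+2 ->
  exists2 theta, theta \in @bsupp K X A n & psi - codiff theta \in @coarse K X A n.+1.
Proof.
move=> /contractible_balls[b contr] /(bsuppP b) psi0 /(coarseP b) dpsi0.
have [|G [G0 psiG]] := bicomplex_zigzag contr psi0.
  move=> r; have [D dD] := dpsi0 r; exists D => -[|u []] // y _ sy cy fy.
  rewrite /dl /= subr0 /dr -seq_cochain_codiff //; apply: (dD [::]) => //.
    by apply: clusteredS cy => // v vy; rewrite inE vy orbT.
  by apply: farS fy => // v vy; rewrite inE vy orbT.
pose theta : cochain X A n := fun s => G [::] (codom s).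
have thetaE y : size y = n.+1 -> seq_cochain b theta y = G [::] y.
  move=> sy; congr (G [::] _); apply: (@eq_from_nth _ b).
    by rewrite size_codom card_ord.
  move=> i; rewrite size_codom card_ord => lin.
  by rewrite (nth_codom_ord b (fun i : 'I_n.+1 => nth b y i) (Ordinal lin)).
exists theta.
  apply/(bsuppP b) => r; have [D GD] := G0 r; exists D => -[|//] z _ cz fz.
  have [e [e0 Ge]] := GD [::] z erefl cz fz; exists e; split=> // y sy ye.
  by rewrite thetaE //; apply: Ge.
apply/(coarseP b) => r; have [D psiD] := psiG r; exists D => -[|//] [|u y] // _ sy cy fy.
(* Taking the first entry of the tuple as [x] adds no new point. *)
have uy : {subset [:: u] ++ u :: y <= u :: y}.
  by move=> v; rewrite /= !inE => /or3P[]->; rewrite ?orbT.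
have := psiD [:: u] (u :: y) erefl sy (clusteredS uy (lexx r) cy) (farS uy (lexx D) fy).
rewrite /dl [LHS]/= subr0 => <-.
rewrite {1}/seq_cochain; congr (_ - _); rewrite -/(seq_cochain b (codiff theta) (u :: y)).
rewrite seq_cochain_codiff //; apply: eq_sdiff => t; rewrite sy => -[st] _.
exact: thetaE.
Qed.

(** The first hypothesis makes the induced map well defined and injective, the second surjective. *)
Lemma quotmod_bijection (A : pzRingType) (V W : lmodType A)
    (S : submodClosed V) (T : submodClosed W) (i : {linear V -> W}) :
  (forall v, (i v \in T) = (v \in S)) -> (forall w, exists v, w - i v \in T) ->
  exists f : {linear quotmod S -> quotmod T}, bijective f.
Proof.
move=> iS iT.
have [g gE] : exists g : quotmod S -> quotmod T,
    forall v, g (quotmod_pi S v) = quotmod_pi T (i v).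
  have /choice[r rP] := @quotmod_pi_surj A V S.
  exists (fun q => quotmod_pi T (i (r q))) => v; apply/quotmod_piP.
  by rewrite -linearB iS; apply/quotmod_piP.
have g_linear : linear g.
  move=> a p q; have [v <-] := quotmod_pi_surj p; have [w <-] := quotmod_pi_surj q.
  have piZ (U : lmodType A) (R : submodClosed U) (u : U) :
    a *: quotmod_pi R u = quotmod_pi R (a *: u) by exact: quotmod_scaleE.
  by rewrite piZ -quotmod_piD !gE linearP quotmod_piD piZ.
pose gL := GRing.isLinear.Build A (quotmod S) (quotmod T) *:%R g g_linear.
pose f : {linear quotmod S -> quotmod T} := HB.pack g gL; exists f.
have g_inj : injective g.
  move=> p q; have [v <-] := quotmod_pi_surj p; have [w <-] := quotmod_pi_surj q.
  rewrite !gE => /quotmod_piP; rewrite -linearB iS => vw; exact/quotmod_piP.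
have /choice[g' g'K] : forall q, exists p, g p = q.
  move=> q; have [w <-] := quotmod_pi_surj q; have [v wv] := iT w.
  exists (quotmod_pi S v); rewrite gE; apply/esym; exact/quotmod_piP.
by exists g' => p //; apply: g_inj.
Qed.

(** * The map induced on cohomology by inclusion *)

Section CoarseToBounded.
Context {K : realType} (X : metricType K) (A : pzRingType) (n : nat).

Definition coarse_incl (c : coarse_cplx X A n) : bsupp_cplx X A n :=
  Submodule (coarse_bsupp (valP c)).

Lemma coarse_incl_linear : linear coarse_incl.
Proof. by move=> a c c'; apply: val_inj. Qed.
HB.instance Definition _ := GRing.isLinear.Build A (coarse_cplx X A n)
  (bsupp_cplx X A n) *:%R coarse_incl coarse_incl_linear.

Lemma coarse_incl_cocycle (z : cocycles (coarse_cplx X A) n) :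
  coarse_incl (val z) \in @cocycle A (bsupp_cplx X A) n.
Proof.
have := valP z; rewrite !unfold_in /cocycle => /eqP dz; apply/eqP/val_inj.
exact: (congr1 val dz).
Qed.

Definition cocycle_incl (z : cocycles (coarse_cplx X A) n) :
  cocycles (bsupp_cplx X A) n := Submodule (coarse_incl_cocycle z).

Lemma cocycle_incl_linear : linear cocycle_incl.
Proof. by move=> a z z'; apply: val_inj; rewrite /= !linearP. Qed.
HB.instance Definition _ := GRing.isLinear.Build A (cocycles (coarse_cplx X A) n)
  (cocycles (bsupp_cplx X A) n) *:%R cocycle_incl cocycle_incl_linear.

End CoarseToBounded.

Section Comparison.
Context {K : realType} (X : metricType K) (A : pzRingType).
Hypothesis contrX : unif_contractible_at_infinity X.

Let point : exists b : X, True.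
Proof. by case: contrX => ? [? [b _]]; exists b. Qed.

(** A boundedly supported primitive [c] of a coarse cocycle is replaced by the coarse
    [c - codiff theta], which has the same coboundary. *)
Lemma coboundary_cocycle_incl n (z : cocycles (coarse_cplx X A) n) :
  (cocycle_incl z \in @coboundary A (bsupp_cplx X A) n) =
  (z \in @coboundary A (coarse_cplx X A) n).
Proof.
have [b _] := point; case: n z => [|n] z.
  rewrite !unfold_in /=; apply/eqP/eqP => [z0|->]; last exact: linear0.
  apply: val_inj; apply: val_inj; exact: (congr1 (fun w => val (val w)) z0).
rewrite !unfold_in /=; apply/asboolP/asboolP => -[c zc]; last first.
  by exists (coarse_incl c); apply: val_inj; rewrite /= zc.
have dc : codiff (val c) = val (val z) by exact: (esym (congr1 val zc)).
have dc_coarse : codiff (val c) \in @coarse K X A n.+1 by rewrite dc; apply: valP.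
(* A primitive of degree [0] is itself coarse, and there is no lower degree for [theta]. *)
case: n z c zc dc dc_coarse => [|n] z c zc dc dc_coarse.
  have c0 := bsupp_coarse_degree0 b (valP c).
  by exists (Submodule c0 : coarse_cplx X A 0); apply: val_inj; rewrite -dc.
have [theta _ ct] := bsupp_coarse_correction contrX (valP c) dc_coarse.
exists (Submodule ct : coarse_cplx X A n.+1); apply: val_inj.
rewrite -dc /= (linearB (@codiff X A n.+1)) /=.
by have := codiff_codiff theta; rewrite /= => ->; rewrite subr0.
Qed.

(** The zero coboundary of [w] is coarse, so the correction applies and gives a cohomologous coarse
    cocycle. *)
Lemma cocycle_incl_onto n (w : cocycles (bsupp_cplx X A) n) :
  exists z, w - cocycle_incl z \in @coboundary A (bsupp_cplx X A) n.
Proof.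
have [b _] := point.
have dw : codiff (val (val w)) = 0.
  by have := valP w; rewrite unfold_in /cocycle => /eqP/(congr1 val).
case: n w dw => [|n] w dw.
  have w0 := bsupp_coarse_degree0 b (valP (val w)).
  have zw : (Submodule w0 : coarse_cplx X A 0) \in @cocycle A (coarse_cplx X A) 0.
    by rewrite unfold_in /cocycle; apply/eqP/val_inj.
  exists (Submodule zw); rewrite unfold_in /= subr_eq0; apply/eqP.
  by apply: val_inj; apply: val_inj.
have dw_coarse : codiff (val (val w)) \in @coarse K X A n.+2 by rewrite dw rpred0.
have [theta th0 ct] := bsupp_coarse_correction contrX (valP (val w)) dw_coarse.
have zw : (Submodule ct : coarse_cplx X A n.+1) \in @cocycle A (coarse_cplx X A) n.+1.
  rewrite unfold_in /cocycle; apply/eqP/val_inj => /=.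
  by rewrite (linearB (@codiff X A n.+1)) /= dw (codiff_codiff theta) subr0.
exists (Submodule zw); rewrite unfold_in /=; apply/asboolP.
exists (Submodule th0 : bsupp_cplx X A n); apply: val_inj.
exact: (subKr (val (val w)) (codiff theta)).
Qed.

End Comparison.

Theorem theorem1p3 (K : realType) (X : metricType K) (A : pzRingType) :
  unif_contractible_at_infinity X ->
  forall n : nat, exists f : {linear coarse_cohomology X A n -> bsupp_cohomology X A n}, bijective f.
Proof.
move=> contrX n.
exact: (quotmod_bijection (coboundary_cocycle_incl contrX (n := n))
  (cocycle_incl_onto contrX (n := n))).
Qed.
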